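(* Let $n\ge 3$ and let $\Gamma$ be any connected simple graph on the vertex set $[n]$. There exist a subset $E_1$ of the set of cut edges of $\Gamma$, a subset $E_2$ of the set of 2-connected subgraphs of $\Gamma$, a non-negative integer $k$, and a function $e\mapsto\lambda_e$ from $E_1$ to the set of partitions of $n$, such that $$\mathbf{ch}(\mathrm{L}_\Gamma)_1=\sum_{e\in E_1}h_{\lambda_e}+\left(|E_2|-1\right)h_{n-1,1}+k\,h_n$$ and $$\mathbf{ch}(\mathrm{R}_\Gamma)_1=\sum_{e\in E_1}\left(h_{\lambda_e}-s_n\right)+|E_2|\,s_{n-1,1}.$$
   Context: Graphs are finite, undirected, without loops or multiple edges; $[n]=\{1,\dots,n\}$. A cut edge of a connected graph is an edge whose deletion (keeping all vertices) disconnects the graph. A graph is 2-connected if it is connected and deleting any one vertex leaves a connected graph (so a single edge with its two endpoints is 2-connected). An edge $(i,j)$ of a graph on $[n]$ is identified with the transposition $(i,j)\in S_n$. Write $\mathbb{C}[t_\bullet]=\mathbb{C}[t_1,\dots,t_n]$; $w\in S_n$ acts on it by $(wf)(t_1,\dots,t_n)=f(t_{w(1)},\dots,t_{w(n)})$. Ring of splines: $\mathcal{M}_\Gamma$ is the set of functions $\bar\rho\colon S_n\to\mathbb{C}[t_\bullet]$ such that $\bar\rho(w)-\bar\rho(w(i,j))\in\langle t_{w(i)}-t_{w(j)}\rangle$ for all $w\in S_n$ and $(i,j)\in E(\Gamma)$, with pointwise operations, graded by polynomial degree. $S_n$ acts by the dot action $(w\cdot\bar\rho)(v)=w\,\bar\rho(w^{-1}v)$.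 Let $\bar t_i(w)=t_i$ and $\bar x_i(w)=t_{w(i)}$, and set $\mathrm{L}_\Gamma=\mathcal{M}_\Gamma/\langle\bar t_1,\dots,\bar t_n\rangle$, $\mathrm{R}_\Gamma=\mathcal{M}_\Gamma/\langle\bar x_1,\dots,\bar x_n\rangle$ (quotients by ideals), finite-dimensional graded $\mathbb{C}$-vector spaces carrying induced graded $S_n$-representations. $\mathbf{ch}(\mathrm{L}_\Gamma)_1$ and $\mathbf{ch}(\mathrm{R}_\Gamma)_1$ are the Frobenius characteristics of their degree-1 pieces. $h_\lambda$ and $s_\lambda$ are the complete homogeneous and Schur symmetric functions. *)

(* Defs.v *)
From HB Require Import structures.
From mathcomp Require Import all_boot all_order all_algebra all_fingroup.
From mathcomp Require Import complex mpoly.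
From mathcomp Require Import boolp reals.
From mathcomp Require classical_sets.

Set Implicit Arguments.
Unset Strict Implicit.
Unset Printing Implicit Defensive.

Import GRing.Theory.
Local Open Scope ring_scope.

Section Graphs.
Variable T : finType.

(* A pair (vertex set, edge set), an edge being the set of its two ends; only
   pairs satisfying [simple_graph] are meant to be graphs. *)
Definition graph : Type := {set T} * {set {set T}}.

Implicit Types G H : graph.

Definition simple_graph G : bool :=
  [forall e in G.2, (#|e| == 2%N) && (e \subset G.1)].

Definition adjacent G : rel T := fun x y => [set x; y] \in G.2.

(* The empty graph is not connected; hence a single vertex is not
   2-connected, while a single edge is. *)
Definition connected_graph G : bool :=
  (G.1 != set0) && [forall x in G.1, forall y in G.1, connect (adjacent G) x y].

Definition delete_edge G (e : {set T}) : graph := (G.1, G.2 :\ e).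

Definition delete_vertex G (x : T) : graph :=
  (G.1 :\ x, [set e in G.2 | x \notin e]).

Definition cut_edges G : {set {set T}} :=
  [set e in G.2 | ~~ connected_graph (delete_edge G e)].

Definition two_connected G : bool :=
  connected_graph G && [forall x in G.1, connected_graph (delete_vertex G x)].

Definition subgraph H G : bool :=
  [&& simple_graph H, H.1 \subset G.1 & H.2 \subset G.2].

Definition two_connected_subgraphs G : {set {set T} * {set {set T}}} :=
  [set H : {set T} * {set {set T}} | subgraph H G && two_connected H].

End Graphs.

Section SubquotientTrace.
Variables (F : fieldType) (U : lmodType F) (V W : U -> Prop).

Definition quotient_basis (d : nat) (b : 'I_d -> U) : Prop :=
  (forall i, V (b i)) /\
  (forall u, V u -> exists! c : 'rV[F]_d, W (u - \sum_i c 0 i *: b i)).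

Definition is_quotient_trace (f : U -> U) (a : F) : Prop :=
  exists (d : nat) (b : 'I_d -> U) (A : 'M[F]_d),
    [/\ quotient_basis b,
        forall j, W (f (b j) - \sum_i A i j *: b i)
      & a = \tr A].

(* The trace of the endomorphism induced by f on V / (V :&: W), for subspaces
   V and W stable under f; 0 is a dummy value used only when this quotient is
   not finite-dimensional. *)
Definition quotient_trace (f : U -> U) : F :=
  classical_sets.xget 0 (is_quotient_trace f).

End SubquotientTrace.

(* A symmetric function is given by its specialisation to N variables for every
   N; two of them are equal when they agree in N variables for all N. *)
Section SymmetricFunctions.
Variables (F : fieldType) (N : nat).

Definition power_sum (d : nat) : {mpoly F[N]} := \sum_(i < N) 'X_i ^+ d.

Definition is_partition (n : nat) (lam : seq nat) : bool :=
  [&& sorted geq lam, 0%N \notin lam & sumn lam == n].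

(* h_d, the sum of 'X_i1 ... 'X_id over i1 <= ... <= id. *)
Definition complete_sym (d : nat) : {mpoly F[N]} :=
  \sum_(t : d.-tuple 'I_N | sorted leq (map val t)) \prod_(i <- t) 'X_i.

Definition complete_sym_part (lam : seq nat) : {mpoly F[N]} :=
  \prod_(d <- lam) complete_sym d.

Definition cell (lam : seq nat) : finType :=
  {c : 'I_(size lam) * 'I_(head 0%N lam) | (c.2 < nth 0%N lam c.1)%N}.

Definition semistandard (lam : seq nat) (T : {ffun cell lam -> 'I_N}) : bool :=
  [forall c : cell lam, forall c' : cell lam,
     [&& (val c).1 == (val c').1 & ((val c).2 < (val c').2)%N] ==> (T c <= T c')%N]
  && [forall c : cell lam, forall c' : cell lam,
     [&& (val c).2 == (val c').2 & ((val c).1 < (val c').1)%N] ==> (T c < T c')%N].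

Definition schur (lam : seq nat) : {mpoly F[N]} :=
  \sum_(T : {ffun cell lam -> 'I_N} | semistandard T) \prod_c 'X_(T c).

Definition frobenius_char (n : nat) (chi : 'S_n -> F) : {mpoly F[N]} :=
  (n`!%:R)^-1 *: \sum_(w : 'S_n) chi w *: \prod_(c in porbits w) power_sum #|c|.

End SymmetricFunctions.

(* Products in {perm T} compose left to right: the permutation written w v in
   the usual notation, x |-> w (v x), is (v * w)%g. *)
Section Splines.
Variables (F : fieldType) (n : nat).

Local Notation spline_fun := {ffun 'S_n -> {mpoly F[n]}}.

Definition act_poly (w : 'S_n) (f : {mpoly F[n]}) : {mpoly F[n]} :=
  f \mPo [tuple 'X_(w i) | i < n].

Definition is_spline (G : graph 'I_n) (rho : spline_fun) : Prop :=
  forall (w : 'S_n) (i j : 'I_n), [set i; j] \in G.2 ->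
    exists q : {mpoly F[n]},
      rho w - rho (tperm i j * w)%g = q * ('X_(w i) - 'X_(w j)).

Definition dot_action (w : 'S_n) (rho : spline_fun) : spline_fun :=
  [ffun v : 'S_n => act_poly w (rho (v * w^-1)%g)].

Definition tbar (i : 'I_n) : spline_fun := [ffun w : 'S_n => 'X_i].

Definition xbar (i : 'I_n) : spline_fun := [ffun w : 'S_n => 'X_(w i)].

(* The ideal generated by g_1, ..., g_n in the ring of splines. *)
Definition spline_ideal (G : graph 'I_n) (g : 'I_n -> spline_fun)
    (rho : spline_fun) : Prop :=
  exists c : 'I_n -> spline_fun,
    (forall i, is_spline G (c i)) /\ rho = \sum_i g i * c i.

Definition spline_degree (G : graph 'I_n) (d : nat) (rho : spline_fun) : Prop :=
  is_spline G rho /\ forall w, rho w \is d.-homog.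

(* Characters of the degree d pieces of the quotients of the ring of splines:
   the degree d piece of M / I is M_d / (M_d :&: I). *)
Definition L_character (G : graph 'I_n) (d : nat) (w : 'S_n) : F :=
  quotient_trace (spline_degree G d) (spline_ideal G tbar) (dot_action w).

Definition R_character (G : graph 'I_n) (d : nat) (w : 'S_n) : F :=
  quotient_trace (spline_degree G d) (spline_ideal G xbar) (dot_action w).

Definition ch_L (N : nat) (G : graph 'I_n) (d : nat) : {mpoly F[N]} :=
  frobenius_char N (L_character G d).

Definition ch_R (N : nat) (G : graph 'I_n) (d : nat) : {mpoly F[N]} :=
  frobenius_char N (R_character G d).

End Splines.

(* Main.v *)
(* Reading a degree 1 spline in the coordinates t_(w 1), ..., t_(w n) turns it into
   functions sg_1, ..., sg_n on S_n, acted on by translation, such that for every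
   edge ij the functions sg_k (k distinct from i and j) and sg_i + sg_j are invariant
   under w |-> w (i,j). Hence sg_i only depends on w i and on the images of the
   components of the graph minus i, and the jump of sg_i along an edge ij that is
   not a bridge depends on w i and w j only: it is phi (w i) - phi (w j), for a function
   phi common to the whole block of ij. Along a bridge, with A the side of i, the
   jump is a cochain on the Johnson graph of |A|-subsets, closed on triangles, hence
   of the form theta (w A) - theta (w (i,j) A). Conversely all such phi and theta
   occur, and they determine the spline up to constants sg_i.

   So both quotients are quotients of the permutation module on the |A|-subsets for
   the bridges, on [n] for the other blocks, and n fixed points, by an
   explicit permuted basis of relations: one fixed relation for each block, and the
   n classes t_k or x_k. Thus E_1 is the set of all bridges, and |E_2| the number of
   other blocks, each being represented in E_2 by one of its edges. *)

Require Import Defs.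
From mathcomp Require Import all_boot all_order all_algebra all_fingroup.
From mathcomp Require Import complex mpoly reals.
From mathcomp Require classical_sets.
From mathcomp Require Import zify.

Set Implicit Arguments.
Unset Strict Implicit.
Unset Printing Implicit Defensive.

Import GRing.Theory.
Local Open Scope ring_scope.

(** * Traces on quotients of permutation modules *)

(** No representation is decomposed. On the quotient of a permutation module by a free family of
    permuted relations, the trace of w is the number of fixed generators minus the number of fixed
    relations. Both quotients have the same generators and lose one h_n for every block; they differ
    in the last n relations. The t_k are permuted like [n] and remove one h_{n-1,1}, while the n
    fixed generators leave k = n - (number of blocks) copies of h_n; so k >= 0 amounts to a bound on
    the number of blocks. The x_k are fixed and cancel the n fixed generators; the -h_n of each
    block then stays with that block and gives h_lambda - s_n for a bridge and h_{n-1,1} - h_n =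
    s_{n-1,1} otherwise. The hard part is the upper bound, that no further splines exist. The
    conditions on a spline only control single transpositions along edges, and they have to be
    integrated to a function of w(A). This is possible since every cycle of a Johnson graph is
    filled by triangles, and on triangles the conditions can be checked. *)

Section QuotientTrace.
Variables (F : fieldType) (U : lmodType F) (V W : U -> Prop) (f : U -> U).
Hypothesis W0 : W 0.
Hypothesis WP : forall a u v, W u -> W v -> W (a *: u + v).
Hypothesis fP : forall a u v, f (a *: u + v) = a *: f u + f v.
Hypothesis fW : forall u, W u -> W (f u).

Lemma subspace_sum (I : finType) (c : I -> F) (u : I -> U) :
  (forall i, W (u i)) -> W (\sum_i c i *: u i).
Proof.
move=> Wu; elim/big_rec: _ => [//|i x _ Wx]; exact: WP.
Qed.

Lemma subspaceD u v : W u -> W v -> W (u + v).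
Proof. by move=> Wu Wv; rewrite -[u]scale1r; apply: WP. Qed.

Lemma subspaceB u v : W u -> W v -> W (u - v).
Proof. by move=> Wu Wv; rewrite addrC -scaleN1r; apply: WP. Qed.

Lemma linear_sum (I : finType) (c : I -> F) (u : I -> U) :
  f (\sum_i c i *: u i) = \sum_i c i *: f (u i).
Proof.
have f0 : f 0 = 0.
  by have := fP (-1) 0 0; rewrite scaler0 addr0 scaleN1r addNr.
have fD x y : f (x + y) = f x + f y by rewrite -[x]scale1r fP !scale1r.
have fZ a x : f (a *: x) = a *: f x by rewrite -[_ *: x]addr0 fP f0 addr0.
rewrite (big_morph f fD f0); exact: eq_bigr.
Qed.

(** The two bases are related modulo W by mutually inverse matrices P and P', and both P A^T and
    A'^T P hold the coordinates of the vectors f (b' l); so A and A' have the same trace. Uniqueness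
    matters because [quotient_trace] selects its value by choice. *)
Lemma quotient_trace_unique a a' :
  is_quotient_trace V W f a -> is_quotient_trace V W f a' -> a = a'.
Proof.
case=> d [b [A [[Vb bP] fb ->]]] [d' [b' [A' [[Vb' bP'] fb' ->]]]].
(* Independence modulo W comes from the uniqueness of the coordinates of g 0, a member of V: adding
   c to them gives coordinates of g 0 again. This needs m > 0; an empty row is zero anyway. *)
have indep m (g : 'I_m -> U) (c : 'rV_m) : quotient_basis V W g ->
    (0 < m)%N -> W (\sum_i c 0 i *: g i) -> c = 0.
  case: m g c => // m g c [Vg gP] _ Wc.
  have [c0 [Wc0 uniq]] := gP (g 0) (Vg 0).
  have -> : c = (c0 + c) - c0 by rewrite addrC addKr.
  apply/eqP; rewrite subr_eq0; apply/eqP; symmetry; apply: uniq.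
  rewrite (_ : _ - _ = (g 0 - \sum_i c0 0 i *: g i) - \sum_i c 0 i *: g i).
    exact: subspaceB.
  rewrite -addrA -opprD -big_split /=; congr (_ - _).
  by apply: eq_bigr => i _; rewrite mxE scalerDl.
have {}indep m (g : 'I_m -> U) (c : 'rV_m) : quotient_basis V W g ->
    W (\sum_i c 0 i *: g i) -> c = 0.
  case: m g c => [|m] g c gb; last exact: indep.
  by move=> _; apply/rowP; case.
have change m m' (g : 'I_m -> U) (g' : 'I_m' -> U) :
    quotient_basis V W g -> (forall j, V (g' j)) ->
    exists P : 'M[F]_(m', m), forall j, W (g' j - \sum_i P j i *: g i).
  case=> _ gP Vg'.
  have /fin_all_exists [c cP] j : exists c : 'rV[F]_m,
      W (g' j - \sum_i c 0 i *: g i).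
    by have [c [Wc _]] := gP _ (Vg' j); exists c.
  exists (\matrix_j c j) => j; move: (cP j); congr (W (_ - _)).
  by apply: eq_bigr => i _; rewrite mxE.
have [P PP] := change _ _ b b' (conj Vb bP) Vb'.
have [P' PP'] := change _ _ b' b (conj Vb' bP') Vb.
have subst m m' k (g : 'I_m -> U) (g' : 'I_m' -> U) (x : 'I_k -> U)
    (Q : 'M[F]_(m', m)) (R : 'M[F]_(k, m')) :
    (forall j, W (g' j - \sum_i Q j i *: g i)) ->
    (forall l, W (x l - \sum_j R l j *: g' j)) ->
    forall l, W (x l - \sum_i (R *m Q) l i *: g i).
  move=> QP RP l.
  rewrite (_ : _ - _ = (x l - \sum_j R l j *: g' j)
      + \sum_j R l j *: (g' j - \sum_i Q j i *: g i)).
    by apply: subspaceD => //; apply: subspace_sum.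
  under [X in _ = _ + X]eq_bigr do rewrite scalerBr.
  rewrite sumrB addrA subrK; congr (_ - _).
  under [RHS]eq_bigr do rewrite scaler_sumr.
  rewrite exchange_big /=; apply: eq_bigr => i _.
  by rewrite mxE scaler_suml; apply: eq_bigr => j _; rewrite scalerA.
have same m k (g : 'I_m -> U) (x : 'I_k -> U) (Q R : 'M[F]_(k, m)) :
    quotient_basis V W g ->
    (forall l, W (x l - \sum_i Q l i *: g i)) ->
    (forall l, W (x l - \sum_i R l i *: g i)) -> Q = R.
  move=> gb QP RP; apply/row_matrixP => l; apply/eqP; rewrite -subr_eq0.
  apply/eqP; apply: indep gb _.
  rewrite (_ : \sum_i _ = (x l - \sum_i R l i *: g i)
      - (x l - \sum_i Q l i *: g i)); first exact: subspaceB.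
  rewrite opprB [RHS]addrC addrA subrK -sumrB.
  by apply: eq_bigr => i _; rewrite !mxE scalerBl.
have fA l : W (f (b l) - \sum_i A^T l i *: b i).
  by move: (fb l); congr (W (_ - _)); apply: eq_bigr => i _; rewrite mxE.
have fA' l : W (f (b' l) - \sum_i A'^T l i *: b' i).
  by move: (fb' l); congr (W (_ - _)); apply: eq_bigr => i _; rewrite mxE.
have fP' l : W (f (b' l) - \sum_i P l i *: f (b i)).
  rewrite -linear_sum -[X in _ - X]scale1r -scaleNr addrC -fP scaleN1r addrC.
  exact: fW.
have e1 : P *m A^T = A'^T *m P.
  by apply: same (subst _ _ _ _ _ _ _ _ fA fP') (subst _ _ _ _ _ _ _ _ PP fA').
have id_coord m (g : 'I_m -> U) l : W (g l - \sum_i (1%:M : 'M[F]_m) l i *: g i).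
  rewrite (bigD1 l) //= big1 ?addr0; last first.
    by move=> i /negPf il; rewrite mxE eq_sym il scale0r.
  by rewrite mxE eqxx scale1r subrr.
have e2 : P' *m P = 1%:M.
  by apply: same (subst _ _ _ _ _ _ _ _ PP PP') (id_coord _ b).
have e3 : P *m P' = 1%:M.
  by apply: same (subst _ _ _ _ _ _ _ _ PP' PP) (id_coord _ b').
rewrite -(mxtrace_tr A) -(mxtrace_tr A') -[A^T]mul1mx -e2 -mulmxA e1.
by rewrite mulmxA mxtrace_mulC mulmxA e3 mul1mx.
Qed.

Hypothesis V0 : V 0.
Hypothesis VP : forall a u v, V u -> V v -> V (a *: u + v).

(* Let P be the matrix of p, and L, R a factorisation of the cokernel of the
   relations with R L = 1, so that 1 - L R = X K. The induced matrix is R P L,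
   and tr (P L R) = tr P - tr (P X K) = tr P - tr Q, as K P = Q K and K X = 1. *)
Lemma quotient_trace_perm (I J : finType) (B : I -> U) (K : J -> I -> F)
    (p : I -> I) (q : J -> J) :
    injective p ->
    (forall i, V (B i)) ->
    (forall u, V u -> exists c : I -> F, W (u - \sum_i c i *: B i)) ->
    (forall c, W (\sum_i c i *: B i) <->
      exists d : J -> F, forall i, c i = \sum_j d j * K j i) ->
    (forall d : J -> F, (forall i, \sum_j d j * K j i = 0) ->
      forall j, d j = 0) ->
    (forall i, f (B i) = B (p i)) ->
    (forall j i, K (q j) (p i) = K j i) ->
  quotient_trace V W f =
    #|[set i | p i == i]|%:R - #|[set j | q j == j]|%:R.
Proof.
move=> p_inj VB surj ker free fB Kpq.
set N := #|I|; set M := #|J|.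
pose KM : 'M[F]_(M, N) := \matrix_(j, i) K (enum_val j) (enum_val i).
pose P : 'M[F]_N := \matrix_(i, i') (enum_val i' == p (enum_val i))%:R.
pose Q : 'M[F]_M := \matrix_(j, j') (enum_val j' == q (enum_val j))%:R.
pose psi (c : 'rV[F]_N) := \sum_i c 0 (enum_rank i) *: B i.
have psiP a c c' : psi (a *: c + c') = a *: psi c + psi c'.
  rewrite /psi scaler_sumr -big_split; apply: eq_bigr => i _ /=.
  by rewrite !mxE scalerDl scalerA.
have psiB c c' : psi (c - c') = psi c - psi c'.
  rewrite (_ : c - c' = -1 *: c' + c); last by rewrite scaleN1r addrC.
  by rewrite psiP scaleN1r addrC.
have psi_mul m (x : 'rV[F]_m) (R : 'M[F]_(m, N)) :
    psi (x *m R) = \sum_i x 0 i *: psi (row i R).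
  rewrite /psi; under [RHS]eq_bigr do rewrite scaler_sumr.
  rewrite exchange_big; apply: eq_bigr => i _ /=; rewrite mxE scaler_suml.
  by apply: eq_bigr => j _; rewrite mxE scalerA.
have psiW c : W (psi c) <-> exists d : 'rV[F]_M, c = d *m KM.
  rewrite /psi ker; split=> [[d dP]|[d ->]].
    exists (\row_j d (enum_val j)); apply/rowP => i.
    have := dP (enum_val i); rewrite enum_valK => ->.
    rewrite mxE (reindex (@enum_val _ (mem J))) /=.
      by apply: eq_bigr => j _; rewrite !mxE.
    by exists enum_rank => j _; rewrite ?enum_valK ?enum_rankK.
  exists (fun j => d 0 (enum_rank j)) => i.
  rewrite mxE (reindex (@enum_rank J)) /=.
    by apply: eq_bigr => j _; rewrite !mxE !enum_rankK.
  by exists enum_val => j _; rewrite ?enum_valK ?enum_rankK.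
have psif c : f (psi c) = psi (c *m P).
  rewrite /psi linear_sum [RHS](reindex_inj p_inj) /=.
  apply: eq_bigr => i _; rewrite fB; congr (_ *: _).
  rewrite mxE (bigD1 (enum_rank i)) //= mxE !enum_rankK eqxx mulr1.
  rewrite big1 ?addr0 // => j ji; rewrite mxE enum_rankK (inj_eq p_inj).
  rewrite eq_sym; case: eqP => [e|]; last by rewrite mulr0.
  by rewrite -e enum_valK eqxx in ji.
have KMfree : row_free KM.
  rewrite -kermx_eq0; apply/eqP/row_matrixP => i; rewrite row0.
  have: row i (kermx KM) *m KM = 0 by apply/sub_kermxP/row_sub.
  set d := row i _ => dK.
  have d0 : forall j, d 0 (enum_rank j) = 0.
    apply: free => k; move/rowP/(_ (enum_rank k)): dK; rewrite !mxE => e.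
    rewrite -[RHS]e [RHS](reindex (@enum_rank J)) /=.
      by apply: eq_bigr => j _; rewrite !mxE !enum_rankK.
    by exists enum_val => j _; rewrite ?enum_valK ?enum_rankK.
  by apply/rowP => j; rewrite -[j]enum_valK d0 mxE.
have KMP : KM *m P = Q *m KM.
  apply/matrixP => j i; rewrite !mxE.
  rewrite [RHS](bigD1 (enum_rank (q (enum_val j)))) //= [X in _ + X]big1; last first.
    move=> k kj; rewrite !mxE; case: eqP => [e|]; last by rewrite mul0r.
    by rewrite -e enum_valK eqxx in kj.
  rewrite addr0 !mxE enum_rankK eqxx mul1r.
  have [p' _ pK] := injF_bij p_inj.
  rewrite (bigD1 (enum_rank (p' (enum_val i)))) //= big1; last first.
    move=> k ki; rewrite !mxE; case: eqP => [e|]; last by rewrite mulr0.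
    have e' : k = enum_rank (p' (enum_val i)).
      by apply: (can_inj enum_valK); apply: p_inj; rewrite -e enum_rankK pK.
    by rewrite e' eqxx in ki.
  by rewrite addr0 !mxE enum_rankK pK eqxx mulr1 -{2}(pK (enum_val i)) Kpq.
pose L := col_base (cokermx KM).
pose R := pinvmx L.
have RL : R *m L = 1%:M by rewrite mulVpmx // col_base_full.
have KL : KM *m L = 0.
  apply: (row_free_inj (row_base_free (cokermx KM))).
  by rewrite -mulmxA mulmx_base mulmx_coker mul0mx.
(* The rows of 1 - L R vanish in the cokernel, so they are combinations of the rows of K; X holds
   the coefficients. *)
pose X := (1%:M - L *m R) *m pinvmx KM.
have XK : X *m KM = 1%:M - L *m R.
  apply: mulmxKpV; rewrite submxE mulmxBl mul1mx.
  have eL : L *m row_base (cokermx KM) = cokermx KM by rewrite mulmx_base.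
  have -> : L *m R *m cokermx KM = cokermx KM.
    by rewrite -{2}eL mulmxA -(mulmxA L) RL mulmx1 eL.
  by rewrite subrr.
have KX : KM *m X = 1%:M.
  apply: (row_free_inj KMfree).
  by rewrite mul1mx -mulmxA XK mulmxBr mulmx1 mulmxA KL mul0mx subr0.
clearbody X; clearbody R; clearbody L.
have tr_enum (T : finType) (g : T -> T) :
    \tr (\matrix_(i < #|T|, i' < #|T|) (enum_val i' == g (enum_val i))%:R
         : 'M[F]_#|T|) = #|[set i | g i == i]|%:R.
  rewrite -(card_imset _ (@enum_rank_inj T)) /mxtrace -sum1_card natr_sum.
  rewrite [RHS]big_mkcond; apply: eq_bigr => i _ /=; rewrite mxE.
  have -> : (i \in enum_rank @: [set k | g k == k]) = (g (enum_val i) == enum_val i).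
    by rewrite -{1}(enum_valK i) (mem_imset _ _ enum_rank_inj) inE.
  by rewrite eq_sym; case: eqP.
have main : is_quotient_trace V W f (#|[set i | p i == i]|%:R - #|[set j | q j == j]|%:R).
  (* The rows of R represent a basis of the quotient, and psi c has the coordinates c L: the
     difference c - c L R = c X K is a combination of relations, and K L = 0 with R L = 1 gives
     uniqueness. *)
  exists (\rank (cokermx KM)), (fun i => psi (row i R)), (R *m P *m L)^T.
  have VB' c : V (psi c).
    by rewrite /psi; elim/big_rec: _ => [//|i x _ Vx]; exact: VP.
  split.
  - split=> // u Vu; have [c cP] := surj u Vu.
    pose c' : 'rV[F]_N := \row_i c (enum_val i).
    have Wc : W (u - psi c').
      move: cP; congr (W (_ - _)); apply: eq_bigr => i _.
      by rewrite mxE enum_rankK.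
    exists (c' *m L); split=> [|x Wx].
      rewrite -psi_mul -[u](subrK (psi c')) -addrA -psiB.
      apply: subspaceD => //; apply/psiW; exists (c' *m X).
      by rewrite -[RHS]mulmxA XK mulmxBr mulmx1 mulmxA.
    have: W (psi (c' - x *m R)).
      rewrite psiB psi_mul -[psi c'](subKr u) addrAC; exact: subspaceB.
    case/psiW => d dP; apply/eqP; rewrite -subr_eq0 -[x]mulmx1 -RL mulmxA.
    by rewrite -mulmxBl dP -mulmxA KL mulmx0.
  - move=> j; rewrite (eq_bigr (fun i => row j (R *m P *m L) 0 i *: psi (row i R))).
      rewrite -psi_mul psif -psiB; apply/psiW.
      exists (row j (R *m P) *m X).
      by rewrite -[in RHS]mulmxA XK mulmxBr mulmx1 mulmxA -!row_mul.
    by move=> i _; rewrite !mxE.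
  - rewrite mxtrace_tr -mulmxA mxtrace_mulC -mulmxA.
    rewrite (_ : L *m R = 1%:M - X *m KM); last by rewrite XK subKr.
    rewrite mulmxBr mulmx1 raddfB /= (tr_enum I p : \tr P = _); congr (_ - _).
    by rewrite mulmxA mxtrace_mulC mulmxA KMP -mulmxA KX mulmx1 (tr_enum J q : \tr Q = _).
rewrite /quotient_trace; apply: (classical_sets.xget_unique 0 main) => a a_tr.
exact: quotient_trace_unique main.
Qed.

End QuotientTrace.

(** * Blocks of a connected graph *)

Lemma connect_ind (T : finType) (P : T -> Prop) (e : rel T) x y :
  (forall u v, e u v -> P u -> P v) -> connect e x y -> P x -> P y.
Proof.
move=> eP /connectP[s es ->]; elim: s x es => //= z s IH x /andP[xz zs] Px.
exact: IH zs (eP _ _ xz Px).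
Qed.

Section Blocks.
Variables (T : finType) (adj : rel T).
Hypothesis adj_sym : ssrbool.symmetric adj.
Hypothesis adj_irr : irreflexive adj.
Hypothesis adj_conn : forall x y, connect adj x y.

Lemma adj_neq x y : adj x y -> x != y.
Proof. by apply: contraTneq => ->; rewrite adj_irr. Qed.

Definition adj_avoiding (i : T) : rel T :=
  [rel x y | [&& adj x y, x != i & y != i]].

Definition linked_avoiding (i : T) : rel T := connect (adj_avoiding i).

Lemma adj_avoiding_sym i : ssrbool.symmetric (adj_avoiding i).
Proof. by move=> x y; rewrite /adj_avoiding /= adj_sym [(y != i) && _]andbC. Qed.

Lemma linked_avoiding0 i x : linked_avoiding i x x.
Proof. exact: connect0. Qed.

Lemma linked_avoiding_sym i x y : linked_avoiding i x y = linked_avoiding i y x.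
Proof. exact/sym_connect_sym/adj_avoiding_sym. Qed.

Lemma linked_avoiding_neq i x y : linked_avoiding i x y -> x != i -> y != i.
Proof.
by apply: (connect_ind (P := fun u => u != i)) => u v /and3P[].
Qed.

Lemma linked_avoiding1 i x y :
  adj x y -> x != i -> y != i -> linked_avoiding i x y.
Proof. by move=> xy xi yi; apply: connect1; rewrite /adj_avoiding /= xy xi yi. Qed.

Lemma linked_avoiding_step i x y z :
  linked_avoiding i x y -> x != i -> adj y z -> z != i -> linked_avoiding i x z.
Proof.
move=> xy xi yz zi; have yi := linked_avoiding_neq xy xi.
exact: connect_trans xy (linked_avoiding1 yz yi zi).
Qed.

(* A block is encoded as a class of directed edges: two edges at i are in the same
   block when their other ends are linked in the graph minus i. *)
Definition same_block_step : rel (T * T) :=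
  [rel p q | [&& adj p.1 p.2, adj q.1 q.2 &
    ((p.1 == q.1) && linked_avoiding p.1 p.2 q.2)
    || ((p.1 == q.2) && (p.2 == q.1))]].

(** The canonical element of the class is again a directed edge, so a block y comes with a
    distinguished edge from [y.1] to [y.2]. *)
Definition block_of (i j : T) : T * T := fingraph.root same_block_step (i, j).

Definition blocks : {set T * T} :=
  [set y | adj y.1 y.2 && (block_of y.1 y.2 == y)].

(** The component of the graph minus i into which the edges of y at i lead; empty if y has no edge
    at i. *)
Definition side (y : T * T) (i : T) : {set T} :=
  [set u | [exists j, [&& adj i j, block_of i j == y & linked_avoiding i j u]]].

Lemma same_block_step_sym : ssrbool.symmetric same_block_step.
Proof.
move=> p q; rewrite /same_block_step /=.
case/boolP: (adj p.1 p.2) => _ /=; last by rewrite andbF.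
case/boolP: (adj q.1 q.2) => _ //=.
rewrite [q.1 == p.1]eq_sym [q.1 == p.2]eq_sym [q.2 == p.1]eq_sym.
rewrite [(p.2 == q.1) && _]andbC; case: eqP => [->|_] //=.
by rewrite linked_avoiding_sym.
Qed.

Lemma same_block_sym : connect_sym same_block_step.
Proof. exact/sym_connect_sym/same_block_step_sym. Qed.

Lemma block_of_eq i j k l :
  (block_of i j == block_of k l) = connect same_block_step (i, j) (k, l).
Proof. exact/root_connect/same_block_sym. Qed.

Lemma block_ofC i j : adj i j -> block_of i j = block_of j i.
Proof.
move=> ij; apply/eqP; rewrite block_of_eq; apply: connect1; rewrite /same_block_step /=.
by rewrite ij adj_sym ij !eqxx orbT.
Qed.

Lemma block_of_linked i j k : adj i j -> adj i k -> linked_avoiding i j k ->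
  block_of i j = block_of i k.
Proof.
move=> ij ik jk; apply/eqP; rewrite block_of_eq; apply: connect1.
rewrite /same_block_step /=.
by rewrite ij ik eqxx jk.
Qed.

Lemma same_block_adj p q :
  connect same_block_step p q -> adj p.1 p.2 -> adj q.1 q.2.
Proof.
by apply: (connect_ind (P := fun p => adj p.1 p.2)) => u v /and3P[].
Qed.

Lemma block_of_blocks i j : adj i j -> block_of i j \in blocks.
Proof.
move=> ij; have cij := connect_root same_block_step (i, j).
rewrite inE (same_block_adj cij ij) /= /block_of -surjective_pairing.
by rewrite root_root //; apply: same_block_sym.
Qed.

(* The end of an edge other than i determines the component of the graph
   minus i that contains the edge. *)
Lemma same_block_linked i j k : adj i j -> adj i k ->
  block_of i j = block_of i k -> linked_avoiding i j k.
Proof.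
pose far (p : T * T) := if p.1 == i then p.2 else p.1.
have far_neq p : adj p.1 p.2 -> far p != i.
  move=> pE; rewrite /far; case: (eqVneq p.1 i) => // <-.
  by rewrite eq_sym adj_neq.
move=> ij ik /eqP; rewrite block_of_eq => ijk.
have: linked_avoiding i (far (i, j)) (far (i, k)); last by rewrite /far /= eqxx.
apply: (connect_ind (P := fun p => linked_avoiding i (far (i, j)) (far p))) ijk
  (connect0 _ _).
(* [far] moves in two ways only, both inside the graph minus i: along the given link when both edges
   start at i, and across the edge when an edge avoiding i is reversed. *)
move=> p q /and3P[pE qE pq] /connect_trans; apply.
case/orP: pq => /andP[]; rewrite /far.
  move=> /eqP <- l; case: eqP => [<-//|_]; exact: connect0.
move=> /eqP e1 /eqP e2; rewrite -e2 e1.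
case: (eqVneq q.2 i) => [e|ne]; first last.
  case: (eqVneq p.2 i) => [_|ne']; first exact: connect0.
  by apply: linked_avoiding1 => //; rewrite -e1.
rewrite ifN; first exact: connect0.
by rewrite -e -e1 eq_sym adj_neq.
Qed.

Lemma side_block i j u : adj i j ->
  (u \in side (block_of i j) i) = linked_avoiding i j u.
Proof.
move=> ij; rewrite inE; apply/existsP/idP => [[k /and3P[ik /eqP e ku]]|ju].
  by apply: connect_trans ku; apply: same_block_linked.
by exists j; rewrite ij eqxx.
Qed.

Lemma notin_side y i : i \notin side y i.
Proof.
rewrite inE; apply/existsP => -[j /and3P[ij _ /linked_avoiding_neq]].
by rewrite eqxx eq_sym adj_neq // => /(_ isT).
Qed.

Lemma side_adj y i k l : adj k l -> k != i -> l != i ->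
  (k \in side y i) = (l \in side y i).
Proof.
move=> kl ki li; rewrite !inE; apply: eq_existsb => j.
congr [&& _, _ & _].
apply: (same_connect_r _ (linked_avoiding1 kl ki li)).
exact/sym_connect_sym/adj_avoiding_sym.
Qed.

Lemma notin_side_other y i j : adj i j -> block_of i j != y -> j \notin side y i.
Proof.
move=> ij; apply: contra; rewrite inE => /existsP[k /and3P[ik /eqP <- kj]].
by rewrite eq_sym (block_of_linked ik ij kj).
Qed.

(** Along a path from i, each alternative carries over to the next vertex, and passing through i or
    j merely switches between the two. *)
Lemma linked_either i j u : adj i j -> linked_avoiding i j u || linked_avoiding j i u.
Proof.
move=> ij; have ji : adj j i by rewrite adj_sym.
apply: (connect_ind (P := fun u => linked_avoiding i j u || linked_avoiding j i u))
  (adj_conn i u) _; last by rewrite linked_avoiding0 orbT.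
move=> v w vw /orP[iv|jv].
  case: (eqVneq w i) => [->|wi]; first by rewrite linked_avoiding0 orbT.
  by rewrite (linked_avoiding_step iv) // eq_sym adj_neq.
case: (eqVneq w j) => [->|wj]; first by rewrite linked_avoiding0.
by rewrite (linked_avoiding_step jv) ?orbT // eq_sym adj_neq.
Qed.

(** Together with [side_inj]: the nonempty sides at i partition the vertices other than i. *)
Lemma side_exists i x : x != i -> exists2 y, y \in blocks & x \in side y i.
Proof.
move=> xi; suff [j ij jx] : exists2 j, adj i j & linked_avoiding i j x.
  by exists (block_of i j); [apply: block_of_blocks | rewrite side_block].
suff: x = i \/ exists2 j, adj i j & linked_avoiding i j x.
  by case=> // e; rewrite e eqxx in xi.
apply: (connect_ind (P := fun u => u = i \/ exists2 j, adj i j & linked_avoiding i j u))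
  (adj_conn i x) (or_introl erefl) => u v uv.
case: (eqVneq v i) => [->|vi]; first by left.
case=> [ui|[j ij ju]]; right; first by exists v; rewrite -?ui // linked_avoiding0.
exists j => //; apply: linked_avoiding_step ju _ uv vi.
by rewrite eq_sym adj_neq.
Qed.

Lemma side_inj y z i x : x \in side y i -> x \in side z i -> y = z.
Proof.
rewrite !inE => /existsP[j /and3P[ij /eqP <- jx]] /existsP[k /and3P[ik /eqP <- kx]].
apply: block_of_linked => //; apply: connect_trans jx _.
by rewrite -/(linked_avoiding _ _ _) linked_avoiding_sym.
Qed.

(** A vertex in both sides, reached from each end while avoiding the other, closes a cycle through
    the edge. *)
Definition bridge (y : T * T) : bool := side y y.1 :&: side y y.2 == set0.

Section Block.
Variable y : T * T.
Hypothesis yB : y \in blocks.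

Lemma block_adj : adj y.1 y.2.
Proof. by have := yB; rewrite inE => /andP[]. Qed.

Lemma block_ofK : block_of y.1 y.2 = y.
Proof. by have := yB; rewrite inE => /andP[_ /eqP]. Qed.

Lemma block_ofK2 : block_of y.2 y.1 = y.
Proof. by rewrite block_ofC ?block_ofK // adj_sym block_adj. Qed.

Lemma in_side1 u : (u \in side y y.1) = linked_avoiding y.1 y.2 u.
Proof. by rewrite -{1}block_ofK side_block // block_adj. Qed.

Lemma in_side2 u : (u \in side y y.2) = linked_avoiding y.2 y.1 u.
Proof. by rewrite -{1}block_ofK2 side_block // adj_sym block_adj. Qed.

Lemma side_cover u : (u \in side y y.1) || (u \in side y y.2).
Proof. by rewrite in_side1 in_side2 linked_either // block_adj. Qed.

Lemma snd_side1 : y.2 \in side y y.1.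
Proof. by rewrite in_side1 linked_avoiding0. Qed.

Lemma fst_side2 : y.1 \in side y y.2.
Proof. by rewrite in_side2 linked_avoiding0. Qed.

Hypothesis y_bridge : bridge y.

Lemma bridge_side u : (u \in side y y.1) = (u \notin side y y.2).
Proof.
have := side_cover u; case: (boolP (u \in _)) => [u1 _|_ /= ->//].
by apply/esym/negP => u2; move/eqP/setP/(_ u): y_bridge; rewrite in_setI in_set0 u1 u2.
Qed.

Lemma bridge_block i j : adj i j -> block_of i j = y ->
  (i, j) = y \/ (j, i) = y.
Proof.
move=> ij yE; have yij : connect same_block_step (y.1, y.2) (i, j).
  by rewrite -block_of_eq yE block_ofK.
apply: (connect_ind (P := fun p => p = y \/ (p.2, p.1) = y) _ yij); last first.
  by left; rewrite -surjective_pairing.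
(* A second neighbour k of i', linked to j' in the graph minus i', would lie in both sides: it is
   reached from j' avoiding i', and from i' by its own edge, avoiding j'. *)
have only i' j' k : (forall u, u \in side y i' -> u \notin side y j') ->
    y = (i', j') \/ y = (j', i') ->
    linked_avoiding i' j' k -> adj i' k -> adj i' j' -> k = j'.
  move=> disj yE' l ik ij'; apply/eqP; apply: contraT => kj.
  have ji : adj j' i' by rewrite adj_sym.
  have yi : block_of i' j' = y.
    by case: yE' => e; [rewrite -[RHS]block_ofK | rewrite -[RHS]block_ofK2]; rewrite e.
  have := disj k; rewrite -yi side_block // l {1}block_ofC // side_block //.
  by rewrite linked_avoiding1 // ?[i' == _]eq_sym ?adj_neq // => /(_ isT).
move=> [p1 p2] [q1 q2] /and3P[/= pE qE pq].
case/orP: pq qE => /andP[/eqP <- ]; last first.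
  by move=> /eqP -> _ /= [e|e]; [right | left].
move=> l qE /= pP; rewrite (only _ _ _ _ _ l) //.
  move=> u; case: pP => yE'; have := bridge_side u; rewrite -yE' /= => -> //.
  by rewrite negbK.
by case: pP => <-; [left | right].
Qed.

(** [side y y.2] is the half containing [y.1]; the bridge is its only exit. An edge out of it must
    end at [y.2], and if it started elsewhere than at [y.1], its start would also be reached from
    [y.2] avoiding [y.1]. *)
Lemma bridge_leave u w : adj u w ->
  u \in side y y.2 -> w \notin side y y.2 -> (u, w) = y.
Proof.
move=> uw u2 w2; have yE := block_adj; have y12 := adj_neq yE.
have wE : w = y.2.
  apply/eqP; apply: contraNT w2 => wy; rewrite in_side2 in u2.
  rewrite in_side2; exact: linked_avoiding_step u2 y12 uw wy.
have uE : u = y.1; last by rewrite uE wE -surjective_pairing.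
apply/eqP; apply: contraLR u2 => uy; rewrite -bridge_side in_side1.
rewrite -wE; apply: linked_avoiding1 => //; first by rewrite adj_sym.
by rewrite wE eq_sym.
Qed.

End Block.

Lemma set2_inj (a b c d : T) : [set a; b] = [set c; d] ->
  (a, b) = (c, d) \/ (a, b) = (d, c).
Proof.
move=> e; have [ca cb] : c \in [set a; b] /\ d \in [set a; b].
  by rewrite e set21 set22.
have [ac bc] : a \in [set c; d] /\ b \in [set c; d] by rewrite -e set21 set22.
move: ac bc ca cb; rewrite !inE.
case/orP => /eqP ->; case/orP => /eqP ->; rewrite ?eqxx ?orbb; [|by left|by right|].
  by move=> _ /eqP ->; left.
by move=> /eqP ->; left.
Qed.

Lemma block_edge_inj : {in blocks &, injective (fun y => [set y.1; y.2])}.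
Proof.
move=> y z yB zB /= /set2_inj e; rewrite -(block_ofK yB) -(block_ofK zB).
by case: e => [[-> ->]//|[-> ->]]; rewrite block_ofC // adj_sym block_adj.
Qed.

(* Every block leads towards x0 from one of its vertices, and at each vertex only
   one block leads towards x0. *)
Lemma card_blocks (x0 : T) : (#|blocks| <= #|T|)%N.
Proof.
pose a y := if x0 \in side y y.1 then y.1 else y.2.
pose b y := if x0 \in side y y.1 then y.2 else y.1.
have abP y : y \in blocks ->
    [/\ adj (a y) (b y), block_of (a y) (b y) = y & linked_avoiding (a y) (b y) x0].
  move=> yB; rewrite /a /b; case: ifP => x1.
    by rewrite block_adj // block_ofK // -in_side1.
  have := side_cover yB x0; rewrite x1 /= in_side2 // => x2.
  by rewrite adj_sym block_adj // block_ofK2.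
have a_inj : {in blocks &, injective a}.
  move=> y z yB zB e; have [ya yE yx] := abP y yB; have [za zE zx] := abP z zB.
  rewrite -yE -zE -e; rewrite -e in za zx; apply: block_of_linked => //.
  by apply: connect_trans yx _; rewrite -/(linked_avoiding _ _ _) linked_avoiding_sym.
by rewrite -(card_in_imset a_inj) max_card.
Qed.

End Blocks.

(** * Potentials on Johnson graphs *)

Section JohnsonGraph.
Variables (T : finType) (F : zmodType).
Implicit Types X Y : {set T}.

Definition exchange (p q : T) (X : {set T}) : {set T} := q |: (X :\ p).

Lemma exchangeK p q X : p \in X -> q \notin X -> exchange q p (exchange p q X) = X.
Proof.
move=> pX qX; apply/setP => x; rewrite !inE.
case: (eqVneq x p) => [->//|_]; case: (eqVneq x q) => [->|//].
by rewrite (negPf qX).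
Qed.

Lemma exchange_in p q r X : q \notin X ->
  exchange q r (exchange p q X) = exchange p r X.
Proof.
move=> qX; apply/setP => x; rewrite !inE.
by case: (eqVneq x q) => [->|]; rewrite ?(negPf qX) ?andbF.
Qed.

Lemma exchange_out p q r X : p \in X -> p != r -> q != r ->
  exchange r p (exchange p q X) = exchange r q X.
Proof.
move=> pX pr qr; apply/setP => x; rewrite !inE.
case: (eqVneq x p) => [->|_]; rewrite ?pX ?pr ?orbT //.
by case: (eqVneq x q) => [->|_]; rewrite ?qr.
Qed.

Lemma card_exchange p q X : p \in X -> q \notin X -> #|exchange p q X| = #|X|.
Proof.
by move=> pX qX; rewrite cardsU1 !inE (negPf qX) andbF [RHS](cardsD1 p) pX.
Qed.

Lemma exchangeD p q X Y : p \in X -> p \notin Y -> q \notin X -> q \in Y ->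
  #|X :\: Y| = #|exchange p q X :\: Y|.+1.
Proof.
move=> pX pY qX qY; rewrite (cardsD1 p) !inE pX pY add1n; congr _.+1.
apply: eq_card => x; rewrite !inE.
by case: (eqVneq x q) => [->|_]; rewrite ?qY ?andbF // andbCA.
Qed.

(* The clique complex of a Johnson graph is simply connected: a cochain that is
   closed on its triangles, of the two kinds p -> q -> r and p, r -> q, has a
   potential. *)
Lemma johnson_potential (X0 : {set T}) (psi : T -> T -> {set T} -> F) :
    (forall X p q, #|X| = #|X0| -> p \in X -> q \notin X ->
      psi q p (exchange p q X) = - psi p q X) ->
    (forall X p q r, #|X| = #|X0| -> p \in X -> q \notin X -> r \notin X ->
      q != r -> psi p q X + psi q r (exchange p q X) = psi p r X) ->
    (forall X p q r, #|X| = #|X0| -> p \in X -> r \in X -> q \notin X ->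
      p != r -> psi p q X + psi r p (exchange p q X) = psi r q X) ->
  exists theta : {set T} -> F, forall X p q,
    #|X| = #|X0| -> p \in X -> q \notin X ->
    psi p q X = theta X - theta (exchange p q X).
Proof.
move=> psiN psi_in psi_out.
(* The potential sums psi along a greedy path from X to X0, trading at each step a point of X \ X0
   for one of X0 \ X; k is fuel, set to |X \ X0| in [theta]. That the exchange picked is immaterial
   is the content of [decr]. *)
pose fix Theta (k : nat) (X : {set T}) {struct k} : F := if k isn't k'.+1 then 0 else
  if [pick z : T * T | (z.1 \in X :\: X0) && (z.2 \in X0 :\: X)] is Some z
  then psi z.1 z.2 X + Theta k' (exchange z.1 z.2 X) else 0.
pose d (X : {set T}) := #|X :\: X0|.
pose theta X := Theta (d X) X.
have dC (X : {set T}) : #|X| = #|X0| -> #|X0 :\: X| = d X.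
  move=> XX0; apply/eqP; rewrite -(eqn_add2l #|X :&: X0|) {1}setIC !cardsID.
  by rewrite XX0.
have mem_ex p q (X : {set T}) x :
    (x \in exchange p q X) = (x == q) || (x != p) && (x \in X).
  by rewrite !inE.
exists theta.
suff main k X p q : (d X <= k)%N -> (d (exchange p q X) <= k)%N ->
    #|X| = #|X0| -> p \in X -> q \notin X ->
    psi p q X = theta X - theta (exchange p q X).
  by move=> X p q; apply: (main (maxn (d X) (d (exchange p q X))));
     rewrite (leq_maxl, leq_maxr).
elim: k X p q => [|k IH] X p q.
  rewrite !leqn0 !cards_eq0 !setD_eq0 => XX0 YX0 cX pX qX.
  have e : X = X0 by apply/eqP; rewrite eqEcard XX0 cX leqnn.
  by move/subsetP/(_ q): YX0; rewrite mem_ex eqxx -e (negPf qX) => /(_ isT).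
have decr Y a b : (d Y <= k.+1)%N -> #|Y| = #|X0| ->
    a \in Y -> a \notin X0 -> b \notin Y -> b \in X0 ->
    psi a b Y = theta Y - theta (exchange a b Y).
  move=> dY cY aY aX0 bY bX0; have dE := exchangeD aY aX0 bY bX0.
  have eqd a' b' : a' \in Y -> a' \notin X0 -> b' \notin Y -> b' \in X0 ->
      d (exchange a' b' Y) = d (exchange a b Y).
    move=> a'Y a'X0 b'Y b'X0; apply: succn_inj.
    by rewrite -[RHS]dE -[LHS]exchangeD.
  have dk : (d (exchange a b Y) <= k)%N by rewrite -ltnS -dE.
  have card_ex a' b' : a' \in Y -> b' \notin Y -> #|exchange a' b' Y| = #|X0|.
    by move=> *; rewrite card_exchange.
  apply/eqP; rewrite eq_sym subr_eq; apply/eqP.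
  rewrite {1}/theta [d Y]dE /=; case: pickP => [[a' b'] /=|]; last first.
    by move/(_ (a, b)); rewrite !inE aY aX0 bY bX0.
  rewrite !inE => /andP[/andP[a'X0 a'Y] /andP[b'Y b'X0]].
  rewrite -/(d _) -(eqd a' b') // -/(theta _); symmetry.
  (* Change first b into b', then a into a'. *)
  transitivity (psi a b' Y + theta (exchange a b' Y)).
    case: (eqVneq b b') => [->//|bb'].
    rewrite -(psi_in Y a b b') // -addrA; congr (_ + _).
    rewrite (IH (exchange a b Y) b b') ?exchange_in ?subrK ?eqd ?card_ex //.
      by rewrite mem_ex eqxx.
    by rewrite mem_ex (negPf b'Y) andbF eq_sym (negPf bb').
  case: (eqVneq a a') => [->//|aa'].
  have b'a' : b' != a' by apply: contraNneq b'Y => ->.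
  rewrite -(psi_out Y a b' a') // -addrA; congr (_ + _).
  rewrite (IH (exchange a b' Y) a' a) ?exchange_out ?subrK ?eqd ?card_ex //.
    by rewrite mem_ex a'Y andbT [a' == a]eq_sym aa' orbT.
  by rewrite mem_ex eqxx /= orbF; apply: contraNneq b'Y => <-.
move=> dX dY cX pX qX; have cY : #|exchange p q X| = #|X0| by rewrite card_exchange.
have pY : p \notin exchange p q X.
  by rewrite mem_ex eqxx /= orbF; apply: contraNneq qX => <-.
have qY : q \in exchange p q X by rewrite mem_ex eqxx.
(* If p and q are both in X0 or both outside, the exchange keeps the distance to X0, and a suitable
   r makes it a side of a triangle whose two other sides are descents. The mixed cases are a
   reversed descent and a descent. *)
case: (boolP (p \in X0)) => pX0; case: (boolP (q \in X0)) => qX0.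
- have /card_gt0P[r] : (0 < #|X :\: X0|)%N.
    by rewrite -[#|_|]/(d X) -dC //; apply/card_gt0P; exists q; rewrite inE qX qX0.
  rewrite inE => /andP[rX0 rX].
  have pr : p != r by apply: contraNneq rX0 => <-.
  have qr : q != r by apply: contraNneq qX => ->.
  have := psi_out X p q r cX pX rX qX pr.
  have rY : r \in exchange p q X by rewrite mem_ex rX [r == p]eq_sym pr orbT.
  rewrite (decr _ r p) // (decr X r q) // exchange_out // => /(canRL (addrK _)) ->.
  by rewrite opprB addrA subrK.
- by apply/eqP; rewrite -eqr_opp -psiN // opprB (decr _ q p) // exchangeK.
- exact: decr.
- have /card_gt0P[r] : (0 < #|X0 :\: X|)%N.
    by rewrite dC //; apply/card_gt0P; exists p; rewrite inE pX pX0.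
  rewrite inE => /andP[rX rX0].
  have qr : q != r by apply: contraNneq qX0 => ->.
  have := psi_in X p q r cX pX qX rX qr.
  have rY : r \notin exchange p q X.
    by rewrite mem_ex (negPf rX) andbF eq_sym (negPf qr).
  rewrite (decr _ q r) // (decr X p r) // exchange_in // => /(canRL (addrK _)) ->.
  by rewrite opprB addrA subrK.
Qed.

End JohnsonGraph.

(** * Functions on a symmetric group invariant under transpositions *)

Section SwapInvariance.
Variable T : finType.
Local Open Scope group_scope.

Lemma tperm_conj (u v w : T) : u != v -> u != w ->
  tperm v w * tperm u v * tperm v w = tperm u w.
Proof.
move=> uv uw; have eu : tperm v w u = u by rewrite tpermD // eq_sym.
by have := tpermJ u v (tperm v w); rewrite tpermL eu conjgE tpermV mulgA.
Qed.

Definition swap_invariant (C : Type) (f : {perm T} -> C) (u v : T) :=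
  forall w, f (tperm u v * w) = f w.

Section Invariance.
Variables (C : Type) (f : {perm T} -> C).

Lemma swap_invariant_refl u : swap_invariant f u u.
Proof. by move=> w; rewrite tperm1 mul1g. Qed.

Lemma swap_invariant_sym u v : swap_invariant f u v -> swap_invariant f v u.
Proof. by rewrite /swap_invariant tpermC. Qed.

Lemma swap_invariant_trans u v w :
  swap_invariant f u v -> swap_invariant f v w -> swap_invariant f u w.
Proof.
move=> uv vw z; case: (eqVneq u w) => [->|uw]; first exact: swap_invariant_refl.
case: (eqVneq v w) => [<-//|vw']; case: (eqVneq u v) => [->//|uv'].
by rewrite -(tperm_conj uv' uw) -!mulgA vw uv vw.
Qed.

Lemma swap_invariant_connect (r : rel T) u v :
  (forall x y, r x y -> swap_invariant f x y) -> connect r u v ->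
  swap_invariant f u v.
Proof.
move=> rP uv; apply: (connect_ind (P := swap_invariant f u)) uv _.
  by move=> x y /rP xy ux; apply: swap_invariant_trans xy.
exact: swap_invariant_refl.
Qed.

(** The transpositions inside the classes of [cl] generate the permutations preserving the classes:
    composing t with the transposition of x and t x fixes x and keeps every fixed point of t. *)
Lemma swap_invariant_stab (K : eqType) (cl : T -> K) (t w : {perm T}) :
  (forall u v, cl u = cl v -> swap_invariant f u v) ->
  (forall x, cl (t x) = cl x) -> f (t * w) = f w.
Proof.
move=> clP; have [m] := ubnP #|[set x | t x != x]|.
elim: m t w => // m IH t w tm tcl.
case: (set_0Vmem [set x | t x != x]) => [t1|[x]].
  suff -> : t = 1 by rewrite mul1g.
  apply/permP => x; rewrite perm1; apply/eqP/negPn.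
  by move/setP/(_ x): t1; rewrite !inE => ->.
rewrite inE => tx; pose s := t * tperm x (t x).
have -> : t = s * tperm x (t x) by rewrite -mulgA tperm2 mulg1.
have sfix y : t y = y -> s y = y.
  move=> ty; rewrite permM ty tpermD //.
    by apply: contraNneq tx => ->; rewrite ty.
  by apply: contraNneq tx => e; rewrite (perm_inj (etrans e (esym ty))) ty.
have sx : s x = x by rewrite permM tpermR.
rewrite -mulgA IH; first by apply: clP; rewrite tcl.
  rewrite -ltnS; apply: leq_trans tm; rewrite ltnS; apply: proper_card.
  apply/properP; split; last by exists x; rewrite inE ?sx ?eqxx.
  by apply/subsetP => y; rewrite !inE; apply: contra_neq => /sfix.
by move=> y; have := tcl y; rewrite permM; case: tpermP => [->|->|//] <-; rewrite tcl.
Qed.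

Lemma swap_invariant_const w w' :
  (forall u v, swap_invariant f u v) -> f w = f w'.
Proof.
move=> fP; rewrite -[w](mulgKV w').
by apply: (@swap_invariant_stab _ (fun=> tt)) => // u v _; apply: fP.
Qed.

End Invariance.

Lemma imset_permM (s v : {perm T}) (A : {set T}) : (s * v) @: A = v @: (s @: A).
Proof. by rewrite -imset_comp; apply: eq_imset => x; rewrite /= permM. Qed.

Lemma imset_perm1 (A : {set T}) : (1 : {perm T}) @: A = A.
Proof. by apply/setP => x; rewrite -{1}[x]perm1 (mem_imset _ _ perm_inj). Qed.

Lemma imset_tperm_id u v (A : {set T}) :
  (u \in A) = (v \in A) -> tperm u v @: A = A.
Proof.
move=> uv; apply/setP => x; rewrite -[x](tpermK u v).
rewrite (mem_imset _ _ perm_inj) tpermK.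
by case: tpermP => [->|->|//]; rewrite uv.
Qed.

Lemma imset_tperm a b (A : {set T}) : a \in A -> b \notin A ->
  tperm a b @: A = exchange a b A.
Proof.
move=> aA bA; have ab : a != b by apply: contraNneq bA => <-.
apply/setP => x; rewrite -{1}[x](tpermK a b) (mem_imset _ _ perm_inj) !inE.
case: tpermP => [->|->|/eqP xa /eqP xb].
- by rewrite (negPf bA) eqxx (negPf ab).
- by rewrite aA eqxx.
- by rewrite (negPf xb) xa.
Qed.

Lemma exchange_tperm a b (v : {perm T}) (A : {set T}) : a \in A -> b \notin A ->
  (tperm a b * v) @: A = exchange (v a) (v b) (v @: A).
Proof.
move=> aA bA; rewrite imset_permM imset_tperm // /exchange imsetU1.
congr (_ |: _); apply/setP => x; rewrite -[x](permKV v) !inE.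
by rewrite !(mem_imset _ _ perm_inj) !inE (inj_eq perm_inj).
Qed.

Lemma perm_imset_exists (A X : {set T}) :
  #|A| = #|X| -> exists v : {perm T}, v @: A = X.
Proof.
have [m] := ubnP #|A :\: X|; elim: m A => // m IH A Am AX.
case: (set_0Vmem (A :\: X)) => [/eqP|[a aP]].
  rewrite setD_eq0 => sAX; exists 1; rewrite imset_perm1.
  by apply/eqP; rewrite eqEcard sAX AX leqnn.
have [aX aA] : a \notin X /\ a \in A by move: aP; rewrite inE => /andP[].
have /card_gt0P[x] : (0 < #|X :\: A|)%N.
  have: #|A :\: X| = #|X :\: A|.
    by apply/eqP; rewrite -(eqn_add2l #|A :&: X|) cardsID setIC cardsID AX.
  by move=> <-; apply/card_gt0P; exists a.
rewrite inE => /andP[xA xX].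
have [] := IH (exchange a x A); last 1 first.
- by move=> v <-; exists (tperm a x * v); rewrite imset_permM imset_tperm.
- by rewrite -ltnS -(exchangeD aA aX xA xX).
- by rewrite card_exchange.
Qed.

(** Serves to prescribe the values of v one at a time: the correction exchanges two values that are
    both in X or both outside it. *)
Lemma perm_set_value c x (v : {perm T}) (A X : {set T}) :
  v @: A = X -> (c \in A) = (x \in X) ->
  exists v' : {perm T},
  [/\ v' @: A = X, v' c = x & forall d, d != c -> v d != x -> v' d = v d].
Proof.
move=> vA cx; exists (v * tperm (v c) x); split; last 1 first.
- by move=> d dc dx; rewrite permM tpermD // eq_sym // (inj_eq perm_inj).
- rewrite imset_permM vA imset_tperm_id //.
  by rewrite -cx -vA (mem_imset _ _ perm_inj).
- by rewrite permM tpermL.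
Qed.

End SwapInvariance.

(** * Integration of a function on the symmetric group to a potential on subsets *)

Section PermPotential.
Variables (T : finType) (F : zmodType) (a b : T) (A : {set T}).
Hypotheses (aA : a \in A) (bA : b \notin A).
Variable D : {perm T} -> F.

Hypothesis D_swap : forall w, D (tperm a b * w)%g = - D w.
Hypothesis D_in : forall k l, k \in A -> l \in A -> k != a -> l != a ->
  swap_invariant D k l.
Hypothesis D_out : forall k l, k \notin A -> l \notin A -> k != b -> l != b ->
  swap_invariant D k l.
Hypothesis D_out3 : (exists2 u, u \notin A & u != b) ->
  exists u, [/\ u \notin A, u != b & forall w,
    D w + D (tperm b u * (tperm a b * w))%g = D (tperm b u * w)%g].
Hypothesis D_in3 : (exists2 u, u \in A & u != a) ->
  exists u, [/\ u \in A, u != a & forall w,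
    D w + D (tperm a u * (tperm a b * w))%g = D (tperm a u * w)%g].

(** D w depends only on w a, w b and w(A), so D descends to a cochain on the directed edges of the
    Johnson graph of the |A|-subsets. [D_swap] is its antisymmetry, [D_out3] and [D_in3] its
    closedness on the two kinds of triangles. One witness u suffices for each kind, since w can be
    chosen to send u to the third point of any given triangle. *)
Lemma perm_potential : exists theta : {set T} -> F, forall w,
  D w = theta (w @: A) - theta ((tperm a b * w)%g @: A).
Proof.
have ab : a != b by apply: contraNneq bA => <-.
have ba : b != a by rewrite eq_sym.
pose psi p q (X : {set T}) :=
  if [pick v : {perm T} | [&& v a == p, v b == q & v @: A == X]] is Some v then D v else 0.
have psiE (v : {perm T}) p q (X : {set T}) :
    v a = p -> v b = q -> v @: A = X -> psi p q X = D v.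
  move=> va vb vA; rewrite /psi.
  case: pickP => [v'|/(_ v)]; last by rewrite va vb vA !eqxx.
  case/and3P => /eqP va' /eqP vb' /eqP vA'; rewrite -[v'](mulgKV v).
  apply: (@swap_invariant_stab _ _ _ _ (fun x => (x \in A, x == a, x == b))).
    move=> k l [kA ka kb]; case: (eqVneq k a) ka => [-> /esym/eqP ->|ka /esym/negbT la].
      exact: swap_invariant_refl.
    case: (eqVneq k b) kb => [-> /esym/eqP ->|kb /esym/negbT lb].
      exact: swap_invariant_refl.
    by case: (boolP (k \in A)) kA => kA /esym lA;
       [apply: D_in | apply: D_out; rewrite ?lA].
  move=> x; rewrite permM; congr (_, _, _).
  - rewrite -[RHS](mem_imset _ _ (@perm_inj _ v')) vA' -vA.
    by rewrite -{2}[v' x](permKV v) (mem_imset _ _ perm_inj).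
  - by rewrite -(inj_eq (@perm_inj _ v)) permKV va -va' (inj_eq perm_inj).
  - by rewrite -(inj_eq (@perm_inj _ v)) permKV vb -vb' (inj_eq perm_inj).
have lift2 p q (X : {set T}) : #|X| = #|A| -> p \in X -> q \notin X ->
    exists v : {perm T}, [/\ v a = p, v b = q & v @: A = X].
  move=> XA pX qX; have pq : p != q by apply: contraNneq qX => <-.
  have [v0 v0A] := perm_imset_exists (esym XA).
  have [|v1 [v1A v1a _]] := @perm_set_value _ a p v0 A X v0A; first by rewrite aA pX.
  have [|v2 [v2A v2b v2x]] := @perm_set_value _ b q _ A X v1A.
    by rewrite (negPf bA) (negPf qX).
  by exists v2; split; rewrite // v2x ?v1a.
have lift3 p q r u (X : {set T}) : #|X| = #|A| -> p \in X -> q \notin X ->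
    r != p -> r != q -> u != a -> u != b -> (u \in A) = (r \in X) ->
    exists v : {perm T}, [/\ v a = p, v b = q, v u = r & v @: A = X].
  move=> XA pX qX rp rq ua ub ur; have [v [va vb vA]] := lift2 p q X XA pX qX.
  have [v' [v'A v'u v'x]] := @perm_set_value _ u r v A X vA ur.
  by exists v'; split; rewrite // v'x ?va ?vb // eq_sym.
(* As X and A have the same size, a third point on one side of X yields a further vertex on the same
   side of A, as the premises of [D_out3] and [D_in3] require. *)
have other (B x : {set T}) y z : y \in B -> z \in B -> y != z ->
    #|B| = #|x| -> forall c, c \in x -> exists2 u, u \in x & u != c.
  move=> yB zB yz Bx c cx; have: (0 < #|x :\ c|)%N.
    move: Bx; rewrite (cardsD1 y) yB (cardsD1 z) !inE eq_sym yz zB (cardsD1 c x) cx.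
    by lia.
  by case/card_gt0P => u; rewrite !inE => /andP[uc ux]; exists u.
have [theta thetaP] : exists theta : {set T} -> F, forall (X : {set T}) p q,
    #|X| = #|A| -> p \in X -> q \notin X ->
    psi p q X = theta X - theta (exchange p q X).
  apply: johnson_potential => [X p q XA pX qX|X p q r XA pX qX rX qr
    |X p q r XA pX rX qX pr].
  - have [v [va vb vA]] := lift2 p q X XA pX qX.
    rewrite (psiE v p q X) // -D_swap; apply: psiE.
    + by rewrite permM tpermL.
    + by rewrite permM tpermR.
    + by rewrite exchange_tperm // va vb vA.
  - have [u [uA ub uP]] : exists u, [/\ u \notin A, u != b & forall w,
        D w + D (tperm b u * (tperm a b * w))%g = D (tperm b u * w)%g].
      apply: D_out3; have [||||u] := other (~: X) (~: A) q r _ _ qr _ b; rewrite ?inE //.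
        by apply/eqP; rewrite -(eqn_add2l #|X|) cardsC XA cardsC.
      by exists u.
    have ua : u != a by apply: contraNneq uA => ->.
    have [v [va vb vu vA]] : exists v : {perm T},
        [/\ v a = p, v b = q, v u = r & v @: A = X].
      apply: lift3; rewrite // 1?[r == q]eq_sym ?(negPf uA) ?(negPf rX) //.
      by apply: contraNneq rX => ->.
    rewrite (psiE v p q X) // (psiE (tperm b u * v)%g p r X); last 3 first.
    + by rewrite permM tpermD // eq_sym.
    + by rewrite permM tpermL.
    + by rewrite imset_permM imset_tperm_id // (negPf bA) (negPf uA).
    rewrite (psiE (tperm b u * (tperm a b * v))%g q r) ?uP //.
    + by rewrite !permM (tpermD ba ua) tpermL.
    + by rewrite !permM tpermL tpermD // eq_sym.
    + rewrite imset_permM imset_tperm_id ?(negPf bA) ?(negPf uA) //.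
      by rewrite exchange_tperm // va vb vA.
  - have [u [uA ua uP]] : exists u, [/\ u \in A, u != a & forall w,
        D w + D (tperm a u * (tperm a b * w))%g = D (tperm a u * w)%g].
      by apply: D_in3; apply: (other X A p r).
    have ub : u != b by apply: contraNneq bA => <-.
    have [v [va vb vu vA]] : exists v : {perm T},
        [/\ v a = p, v b = q, v u = r & v @: A = X].
      apply: lift3; rewrite // 1?[r == p]eq_sym ?uA ?rX //.
      by apply: contraNneq qX => <-.
    rewrite (psiE v p q X) // (psiE (tperm a u * v)%g r q X); last 3 first.
    + by rewrite permM tpermL.
    + by rewrite permM tpermD // eq_sym.
    + by rewrite imset_permM imset_tperm_id // aA uA.
    rewrite (psiE (tperm a u * (tperm a b * v))%g r p) ?uP //.
    + by rewrite !permM tpermL tpermD // eq_sym.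
    + by rewrite !permM (tpermD ab ub) tpermR.
    + rewrite imset_permM imset_tperm_id ?aA ?uA //.
      by rewrite exchange_tperm // va vb vA.
exists theta => w; rewrite -(psiE w (w a) (w b) (w @: A)) // thetaP //.
- by rewrite exchange_tperm.
- exact/card_imset/perm_inj.
- by rewrite (mem_imset _ _ perm_inj).
- by rewrite (mem_imset _ _ perm_inj).
Qed.

End PermPotential.

(** * Splines of degree 1 in position coordinates *)

Section LinearSplines.
Variables (F : fieldType) (T : finType) (adj : rel T).
Hypothesis adj_sym : ssrbool.symmetric adj.
Hypothesis adj_irr : irreflexive adj.
Hypothesis adj_conn : forall x y, connect adj x y.

Local Notation block_of := (block_of adj).
Local Notation blocks := (blocks adj).
Local Notation side := (side adj).
Local Notation bridge := (bridge adj).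
Local Notation linked_avoiding := (linked_avoiding adj).

(* A spline rho of degree 1 is encoded by its coefficients in position
   coordinates: sg i w is the coefficient of t_(w i) in rho w. *)
Implicit Types sg : T -> {perm T} -> F.

Definition linear_spline sg : Prop := forall i j, adj i j ->
  (forall k, k != i -> k != j -> swap_invariant (sg k) i j) /\
  swap_invariant (fun w => sg i w + sg j w) i j.

Definition jump sg i j (w : {perm T}) : F := sg i w - sg i (tperm i j * w)%g.

Section Jumps.
Variable sg : T -> {perm T} -> F.
Hypothesis sgP : linear_spline sg.

Lemma linked_swap i k l : linked_avoiding i k l -> swap_invariant (sg i) k l.
Proof.
apply: swap_invariant_connect => x y /and3P[xy xi yi].
by apply: (sgP xy).1; rewrite eq_sym.
Qed.

Lemma jumpC i j w : adj i j -> jump sg i j w = - jump sg j i w.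
Proof.
move=> ij; have /= h := (sgP ij).2 w; rewrite /jump [tperm j i]tpermC opprB.
by apply/eqP; rewrite subr_eq addrAC eq_sym subr_eq addrC h.
Qed.

Lemma jump_swap i j w : jump sg i j (tperm i j * w)%g = - jump sg i j w.
Proof. by rewrite /jump mulgA tperm2 mul1g opprB. Qed.

Lemma tperm_comm (i j k l : T) : k != i -> k != j -> l != i -> l != j ->
  (tperm i j * tperm k l = tperm k l * tperm i j)%g.
Proof.
move=> ki kj li lj; apply/permP => x; rewrite !permM.
case: (tpermP k l x) => [->|->|/eqP xk /eqP xl].
- by rewrite [tperm i j k]tpermD 1?eq_sym // tpermL tpermD // eq_sym.
- by rewrite [tperm i j l]tpermD 1?eq_sym // tpermR tpermD // eq_sym.
- by case: (tpermP i j x) => _; rewrite tpermD // eq_sym.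
Qed.

Lemma linked_jump i j k l : linked_avoiding i k l ->
  k != i -> k != j -> l != i -> l != j -> swap_invariant (jump sg i j) k l.
Proof.
move=> ikl ki kj li lj w; rewrite /jump mulgA tperm_comm // -mulgA.
by rewrite !(linked_swap ikl).
Qed.

Lemma linked_jump2 i j k l : adj i j -> linked_avoiding j k l ->
  k != i -> k != j -> l != i -> l != j -> swap_invariant (jump sg i j) k l.
Proof. by move=> ij *; move=> w; rewrite !(jumpC _ ij) linked_jump. Qed.

(** [sg i] is invariant under (j,k), and (j,k) conjugates (i,j) into (i,k). Thus the jumps along the
    edges of a block determine each other, and one representative edge is enough. *)
Lemma jump_linked_eq i j k w : linked_avoiding i j k -> k != i ->  j != i ->
  jump sg i k w = jump sg i j (tperm j k * w)%g.
Proof.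
move=> ijk ki ji; case: (eqVneq j k) => [->|jk]; first by rewrite tperm1 mul1g.
rewrite /jump -[in RHS](linked_swap ijk) mulgA tperm2 mul1g; congr (_ - _).
rewrite -[RHS](linked_swap ijk); congr (sg i _); rewrite !mulgA; congr (_ * _)%g.
by rewrite tperm_conj // eq_sym.
Qed.

(** As [sg i] is invariant under (j,u), the left side telescopes; what is left agrees with the right
    side by the braid relation (i,j)(j,u)(i,j) = (j,u)(i,j)(j,u). *)
Lemma jump_triangle i j u w : linked_avoiding i j u -> i != j -> u != i -> u != j ->
  jump sg i j w + jump sg i j (tperm j u * (tperm i j * w))%g
  = jump sg i j (tperm j u * w)%g.
Proof.
move=> l ij ui uj; rewrite /jump !(linked_swap l) addrA subrK; congr (_ - _).
rewrite -[RHS](linked_swap l) !mulgA; congr (sg _ (_ * _)%g).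
have iu : i != u by rewrite eq_sym.
rewrite (tperm_conj ij iu) [tperm i u]tpermC -(tperm_conj uj ui).
by rewrite [tperm j i]tpermC [tperm u j]tpermC.
Qed.

Lemma jump_eq0_block p q : connect (same_block_step adj) p q ->
  (forall w, jump sg p.1 p.2 w = 0) -> forall w, jump sg q.1 q.2 w = 0.
Proof.
move=> pq; apply: (connect_ind (P := fun q => forall w, jump sg q.1 q.2 w = 0)) pq.
move=> {p q} p q /and3P[pE qE]; case/orP=> /andP[/eqP e]; last first.
  by move=> /eqP e' z w; rewrite -e -e' jumpC ?z ?oppr0 // adj_sym.
move=> l z w; rewrite -e in qE *; rewrite (jump_linked_eq _ l) ?z //.
  by rewrite eq_sym (adj_neq adj_irr).
by rewrite eq_sym (adj_neq adj_irr).
Qed.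

(** Vanishing spreads from the representative of a block to all its edges, and the transpositions
    along the edges of a connected graph generate the symmetric group. So the jumps determine a
    spline up to constants. *)
Lemma jump_eq0_const :
  (forall y, y \in blocks -> forall w, jump sg y.1 y.2 w = 0) ->
  forall i w w', sg i w = sg i w'.
Proof.
move=> y0 i w w'; apply: swap_invariant_const => u v.
apply: (swap_invariant_connect _ (adj_conn u v)) => x z xz.
have j0 k l : adj k l -> forall w, jump sg k l w = 0.
  move=> kl; have := y0 _ (block_of_blocks adj_sym kl).
  apply: (@jump_eq0_block _ (k, l)).
  by rewrite same_block_sym //; apply: connect_root.
case: (eqVneq i x) => [->|ix].
  by move=> w0; apply/esym/eqP; rewrite -subr_eq0; apply/eqP/j0.
case: (eqVneq i z) => [->|iz]; last exact: (sgP xz).1.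
move=> w0; rewrite tpermC; apply/esym/eqP; rewrite -subr_eq0; apply/eqP/j0.
by rewrite adj_sym.
Qed.

End Jumps.

(** The set A whose images carry the potential: the half of [y.1] for a bridge, and a singleton for
    any other block, where the jump depends on the values at the two ends only. *)
Definition block_side (y : T * T) : {set T} :=
  if bridge y then side y y.2 else [set y.1].

Lemma fst_block_side y : y \in blocks -> y.1 \in block_side y.
Proof.
by move=> yB; rewrite /block_side; case: ifP; rewrite ?set11 ?fst_side2.
Qed.

Lemma snd_block_side y : y \in blocks -> y.2 \notin block_side y.
Proof.
move=> yB; rewrite /block_side; case: ifP; first by rewrite notin_side.
by rewrite inE eq_sym (adj_neq adj_irr) // block_adj.
Qed.

Lemma jump_potential sg y : linear_spline sg -> y \in blocks ->
  exists theta : {set T} -> F, forall w, jump sg y.1 y.2 w =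
    theta (w @: block_side y) - theta ((tperm y.1 y.2 * w)%g @: block_side y).
Proof.
move=> sgP yB; have yE := block_adj yB; have y12 := adj_neq adj_irr yE.
have y21 : y.2 != y.1 by rewrite eq_sym.
have a_side := fst_block_side yB; have b_side := snd_block_side yB.
apply: perm_potential => //; rewrite ?(negPf b_side) //.
- by move=> w; apply: jump_swap.
- move=> k l kA lA k1 l1.
  have k2 : k != y.2 by apply: contraNneq b_side => <-.
  have l2 : l != y.2 by apply: contraNneq b_side => <-.
  move: kA lA; rewrite /block_side; case: ifP => [yb|_].
    rewrite !in_side2 // => kb lb; apply: linked_jump2 => //.
    by apply: connect_trans lb; rewrite -/(linked_avoiding _ _ _) linked_avoiding_sym.
  by rewrite inE (negPf k1).
- move=> k l kA lA k2 l2.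
  have k1 : k != y.1 by apply: contraNneq kA => ->.
  have l1 : l != y.1 by apply: contraNneq lA => ->.
  move: kA lA; rewrite /block_side; case: ifP => [yb|/negbT /set0Pn[u]].
    rewrite -!bridge_side // !in_side1 // => ka la; apply: linked_jump => //.
    by apply: connect_trans la; rewrite -/(linked_avoiding _ _ _) linked_avoiding_sym.
  (* The vertex u common to both sides is linked to every other vertex x in the graph minus one of
     the two ends, and either kind of link makes the jump invariant under (x,u). *)
  rewrite in_setI in_side1 // in_side2 // => /andP[ub ua] _ _.
  have u1 : u != y.1 by apply: linked_avoiding_neq ub y21.
  have u2 : u != y.2 by apply: linked_avoiding_neq ua y12.
  have swap x : x != y.1 -> x != y.2 -> swap_invariant (jump sg y.1 y.2) x u.
    move=> x1 x2; case/orP: (linked_either adj_sym adj_irr adj_conn x yE) => lx.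
      apply: linked_jump => //.
      by apply: connect_trans ub; rewrite -/(linked_avoiding _ _ _) linked_avoiding_sym.
    apply: linked_jump2 => //.
    by apply: connect_trans ua; rewrite -/(linked_avoiding _ _ _) linked_avoiding_sym.
  exact: swap_invariant_trans (swap k k1 k2) (swap_invariant_sym (swap l l1 l2)).
- case=> u uA u2; rewrite /block_side in uA *; case: ifP uA => [yb|/negbT /set0Pn[v]].
    move=> uA; exists u; split=> // w; apply: jump_triangle => //.
      by rewrite -in_side1 // bridge_side.
    by apply: contraNneq uA => ->; rewrite fst_side2.
  rewrite in_setI in_side1 // in_side2 // => /andP[vb va] _.
  have v1 : v != y.1 by apply: linked_avoiding_neq vb y21.
  have v2 : v != y.2 by apply: linked_avoiding_neq va y12.
  by exists v; split=> // [|w]; [rewrite inE | apply: jump_triangle].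
- case=> u uA u1; rewrite /block_side in uA *; case: ifP uA => [yb|_]; last first.
    by rewrite inE (negPf u1).
  move=> uA; exists u; split=> // w; rewrite !(jumpC sgP _ yE) -opprD; congr (- _).
  rewrite in_side2 // in uA; rewrite [tperm y.1 y.2]tpermC.
  by apply: jump_triangle => //; apply: linked_avoiding_neq uA y12.
Qed.

(* For a bridge y = (i, j), with A the side of i, this is the spline
   w |-> [w(A) = S] (t_(w i) - t_(w j)). For another block S is a singleton {k},
   and the spline is minus the sum of the t_(w i) over the vertices i of the block
   from which w^-1 k is reached through the block. *)
Definition block_spline (y : T * T) (S : {set T}) (i : T) (w : {perm T}) : F :=
  if bridge y
  then ((i == y.1)%:R - (i == y.2)%:R) * (w @: block_side y == S)%:R
  else - (S \subset w @: side y i)%:R.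

Section BlockSpline.
Variables (y : T * T) (S : {set T}).
Hypothesis yB : y \in blocks.

Lemma bridge_sideC u : bridge y -> (u \in side y y.2) = (u \notin side y y.1).
Proof. by move=> yb; rewrite (bridge_side adj_sym adj_irr adj_conn yB yb) negbK. Qed.

Lemma block_spline_swap i u v : (u \in side y i) = (v \in side y i) ->
  swap_invariant (block_spline y S i) u v.
Proof.
move=> uv w; rewrite /block_spline; case: ifP => yb; last first.
  by rewrite imset_permM imset_tperm_id.
rewrite imset_permM /block_side yb.
case: (eqVneq i y.1) uv => [->|_].
  by move=> uv; rewrite imset_tperm_id // !bridge_sideC // uv.
case: (eqVneq i y.2) => [->|_] uv; first by rewrite imset_tperm_id.
by rewrite subrr !mul0r.
Qed.

Lemma block_spline_other i j : adj i j -> block_of i j != y ->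
  swap_invariant (block_spline y S i) i j.
Proof.
move=> ij ijy; apply: block_spline_swap.
by rewrite (negPf (notin_side adj_irr _ _)) (negPf (notin_side_other adj_sym ij ijy)).
Qed.

Hypothesis S_card : #|S| = #|block_side y|.

Lemma nonbridge_card : ~~ bridge y -> exists r, S = [set r].
Proof.
move=> /negPf yb; move: S_card; rewrite /block_side yb cards1 => /eqP/cards1P.
by case=> r ->; exists r.
Qed.

Lemma block_spline_linear : linear_spline (block_spline y S).
Proof.
move=> i j ij; split=> [k ki kj|].
  by apply: block_spline_swap; apply: side_adj; rewrite // eq_sym.
case: (eqVneq (block_of i j) y) => [ijy|ijy] w; last first.
  congr (_ + _); first exact: block_spline_other.
  rewrite tpermC; apply: block_spline_other; first by rewrite adj_sym.
  by rewrite -block_ofC.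
have ji : adj j i by rewrite adj_sym.
have jiy : block_of j i = y by rewrite -block_ofC.
have ij' := adj_neq adj_irr ij.
case: (boolP (bridge y)) => yb.
  have z w' : block_spline y S i w' + block_spline y S j w' = 0.
    rewrite /block_spline yb -mulrDl.
    case: (bridge_block adj_sym adj_irr adj_conn yB yb ij ijy) => <- /=;
    by rewrite !eqxx [j == i]eq_sym (negPf ij') subr0 sub0r ?subrr ?addNr mul0r.
  by rewrite !z.
have [r rE] := nonbridge_card yb; rewrite /block_spline (negPf yb) rE !sub1set.
rewrite !imset_permM -[r](permKV w) !(mem_imset _ _ perm_inj).
set x := (w^-1)%g r; rewrite -!opprD -!natrD; congr (- _%:R).
rewrite -[x](tpermK i j) !(mem_imset _ _ perm_inj) tpermK.
have ii : i \in side y i = false by apply/negbTE/notin_side.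
have jj : j \in side y j = false by apply/negbTE/notin_side.
have ijs : j \in side y i by rewrite -ijy side_block // linked_avoiding0.
have jis : i \in side y j by rewrite -jiy side_block // linked_avoiding0.
(* For x = i or x = j exactly one of the two sides contains x, and (i,j) exchanges these cases; any
   other x is fixed. *)
case: (tpermP i j x) => [->|->|/eqP xi /eqP xj]; rewrite ?tpermL ?tpermR.
- by rewrite ii jj ijs jis.
- by rewrite ii jj ijs jis.
- by [].
Qed.

(** In both cases the indicator of S is a potential of the jump; the minus sign in [block_spline] is
    there for this. *)
Lemma block_spline_jump w : jump (block_spline y S) y.1 y.2 w =
  (w @: block_side y == S)%:R - ((tperm y.1 y.2 * w)%g @: block_side y == S)%:R.
Proof.
have yE := block_adj yB; have y12 := adj_neq adj_irr yE.
rewrite /jump /block_spline; case: ifP => [yb|/negbT yb].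
  by rewrite eqxx (negPf y12) subr0 !mul1r.
have [r ->] := nonbridge_card yb; rewrite /block_side (negPf yb) !sub1set.
rewrite !imset_set1 !(inj_eq (@set1_inj _)) permM tpermL.
rewrite imset_permM -[r](permKV w) !(mem_imset _ _ perm_inj) !(inj_eq perm_inj).
set x := (w^-1)%g r; rewrite opprK addrC.
rewrite -[X in X \in tperm _ _ @: _](tpermK y.1 y.2) !(mem_imset _ _ perm_inj).
have s1 : y.1 \in side y y.1 = false by apply/negbTE/notin_side.
have s2 : y.2 \in side y y.1 by rewrite snd_side1.
case: (tpermP y.1 y.2 x) => [->|->|/eqP x1 /eqP x2].
- by rewrite s1 s2 eqxx eq_sym (negPf y12).
- by rewrite s1 s2 eqxx (negPf y12) sub0r.
- by rewrite ![_ == x]eq_sym (negPf x1) (negPf x2) !subrr.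
Qed.

End BlockSpline.

(** * Generators and relations for the splines of degree 1 *)

Definition block_index : finType :=
  {p : (T * T) * {set T} | (p.1 \in blocks) && (#|p.2| == #|block_side p.1|)}.

(** These span the splines of degree 1 but are dependent, with one relation for each block. The
    index [inr k] stands for x_k, whose coefficients in position coordinates are constant. *)
Definition basis_spline (z : block_index + T) (i : T) (w : {perm T}) : F :=
  match z with
  | inl p => block_spline (val p).1 (val p).2 i w
  | inr k => (i == k)%:R
  end.

Definition combination (c : block_index + T -> F) (i : T) (w : {perm T}) : F :=
  \sum_z c z * basis_spline z i w.

Lemma block_indexP (p : block_index) :
  (val p).1 \in blocks /\ #|(val p).2| = #|block_side (val p).1|.
Proof. by case: p => p /= /andP[yB /eqP]. Qed.

Lemma basis_spline_linear z : linear_spline (basis_spline z).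
Proof.
case: z => [p|k]; first by have [yB pS] := block_indexP p; apply: block_spline_linear.
by move=> i j _; split.
Qed.

Lemma combination_linear c : linear_spline (combination c).
Proof.
move=> i j ij; split=> [k ki kj|] w; rewrite /combination.
  by apply: eq_bigr => z _; rewrite (basis_spline_linear z ij).1.
rewrite -!big_split; apply: eq_bigr => z _ /=; rewrite -!mulrDr.
by have /= -> := (basis_spline_linear z ij).2 w.
Qed.

Lemma linear_splineB sg sg' : linear_spline sg -> linear_spline sg' ->
  linear_spline (fun i w => sg i w - sg' i w).
Proof.
move=> sgP sgP' i j ij; split=> [k ki kj|] w.
  by rewrite (sgP _ _ ij).1 // (sgP' _ _ ij).1.
have /= e := (sgP _ _ ij).2 w; have /= e' := (sgP' _ _ ij).2 w.
by rewrite addrACA -opprD e e' opprD addrACA.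
Qed.

(* The value of c at the basis element (y, S), or 0 if S has the wrong size. *)
Definition block_coef (c : block_index + T -> F) (y : T * T) (S : {set T}) : F :=
  if insub (y, S) is Some p then c (inl p) else 0.

Lemma block_coef_val c (p : block_index) :
  block_coef c (val p).1 (val p).2 = c (inl p).
Proof. by rewrite /block_coef -surjective_pairing valK. Qed.

Lemma sum_block_index c y (w : {perm T}) : y \in blocks ->
  \sum_(p : block_index | (val p).1 == y)
    c (inl p) * (w @: block_side y == (val p).2)%:R
  = block_coef c y (w @: block_side y).
Proof.
move=> yB; rewrite /block_coef; case: insubP => [p _ pE|]; last first.
  by rewrite /= yB card_imset ?eqxx //; apply: perm_inj.
rewrite (bigD1 p) /= ?pE //= eqxx mulr1 big1 ?addr0 // => q /andP[/eqP qy qp].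
case: eqP => [e|]; last by rewrite mulr0.
by case/eqP: qp; apply: val_inj; rewrite pE [val q]surjective_pairing qy -e.
Qed.

(** The splines of the other blocks and the x_k have no jump along the edge of y, so the
    coefficients at y are themselves a potential. *)
Lemma jump_combination c y w : y \in blocks ->
  jump (combination c) y.1 y.2 w = block_coef c y (w @: block_side y)
    - block_coef c y ((tperm y.1 y.2 * w)%g @: block_side y).
Proof.
move=> yB; have yE := block_adj yB; rewrite -!sum_block_index // -sumrB.
rewrite /jump /combination -sumrB big_sumType /= [X in _ + X]big1 ?addr0; last first.
  by move=> k _; rewrite subrr.
rewrite (bigID (fun p : block_index => (val p).1 == y)) /= [X in _ + X]big1 ?addr0.
  apply: eq_bigr => p /eqP py; have [pB pS] := block_indexP p.
  by rewrite -!mulrBr -py -(block_spline_jump pB pS).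
move=> p py; have [pB pS] := block_indexP p.
by rewrite -mulrBr block_spline_other ?subrr ?mulr0 // block_ofK // eq_sym.
Qed.

Lemma combination_surj sg : linear_spline sg ->
  exists c, forall i w, sg i w = combination c i w.
Proof.
move=> sgP.
have /fin_all_exists [theta thetaP] (y : T * T) : exists theta : {set T} -> F,
    y \in blocks -> forall w, jump sg y.1 y.2 w =
      theta (w @: block_side y) - theta ((tperm y.1 y.2 * w)%g @: block_side y).
  case: (boolP (y \in blocks)) => yB; last by exists (fun=> 0).
  by have [theta thetaP] := jump_potential sgP yB; exists theta.
pose c0 (z : block_index + T) := if z is inl p then theta (val p).1 (val p).2 else 0 : F.
have tauP := linear_splineB sgP (combination_linear c0).
have tau0 := jump_eq0_const tauP.
(* The remainder sg - [combination c0] has no jumps, hence is constant in w; its value at 1 gives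
   the coefficients of the x_k. *)
exists (fun z => if z is inr k then sg k 1%g - combination c0 k 1%g else c0 z) => i w.
have c0E : combination c0 i w
    = \sum_(p : block_index) c0 (inl p) * basis_spline (inl p) i w.
  by rewrite /combination big_sumType /= [X in _ + X]big1 ?addr0 // => k _; rewrite mul0r.
rewrite {1}/combination big_sumType /= -c0E (bigD1 i) //= eqxx mulr1.
rewrite big1 ?addr0; last by move=> k /negPf ki; rewrite eq_sym ki mulr0.
have -> : sg i 1%g - combination c0 i 1%g = sg i w - combination c0 i w.
  apply: tau0 => y yB v.
  transitivity (jump sg y.1 y.2 v - jump (combination c0) y.1 y.2 v).
    by rewrite /jump !opprD !opprK addrACA.
  have coefE (v' : {perm T}) :
      block_coef c0 y (v' @: block_side y) = theta y (v' @: block_side y).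
    rewrite /block_coef; case: insubP => [p _ /= ->//|].
    by rewrite /= yB card_imset ?eqxx //; apply: perm_inj.
  by rewrite jump_combination // thetaP // !coefE subrr.
by rewrite addrC subrK.
Qed.

(** The value at i of the sum of the block splines of y over all S. It does not depend on w: for a
    bridge exactly one S equals w(A), and for another block |side y i| singletons lie in w(side y
    i). *)
Definition block_total (y : T * T) (i : T) : F :=
  if bridge y then (i == y.1)%:R - (i == y.2)%:R else - #|side y i|%:R.

Lemma sum_block_spline y i w : y \in blocks ->
  \sum_(p : block_index | (val p).1 == y) block_spline y (val p).2 i w
  = block_total y i.
Proof.
move=> yB; rewrite /block_total.
case: (boolP (bridge y)) => yb.
  under eq_bigr do rewrite /block_spline yb.
  have := sum_block_index (fun=> (i == y.1)%:R - (i == y.2)%:R) w yB.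
  rewrite /= => ->; rewrite /block_coef; case: insubP => //.
  by rewrite /= yB card_imset ?eqxx //; apply: perm_inj.
have sizeE (S : {set T}) : (#|S| == #|block_side y|) = (#|S| == 1%N).
  by rewrite /block_side (negPf yb) cards1.
under eq_bigr do rewrite /block_spline (negPf yb).
rewrite sumrN; congr (- _).
rewrite -(card_imset _ (@perm_inj _ w)) -sum1_card natr_sum [RHS]big_mkcond /=.
have ok (r : T) : ((y, [set r]).1 \in blocks)
    && (#|(y, [set r]).2| == #|block_side (y, [set r]).1|).
  by rewrite /= yB sizeE cards1.
(* The sets S indexing this block are the singletons; [y.1] is a default for other sets. *)
rewrite (reindex_onto (fun r => Sub (y, [set r]) (ok r) : block_index)
    (fun p => if [pick r | (val p).2 == [set r]] is Some r then r else y.1)) /=.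
  apply: eq_big => [r|r _]; rewrite ?SubK /=.
    rewrite eqxx; case: pickP => [r' /eqP/set1_inj <-|/(_ r)]; rewrite ?eqxx //.
  by rewrite sub1set; case: ifP.
move=> p py; apply: val_inj; rewrite SubK.
have [pB /eqP] := block_indexP p; rewrite (eqP py) sizeE => /cards1P[r rE].
rewrite [RHS]surjective_pairing (eqP py) rE; case: pickP => [r' /eqP/set1_inj ->//|].
by move/(_ r); rewrite eqxx.
Qed.

Definition blockT : finType := {y in blocks}.

(* Adding a constant to the coefficients of the block splines of one block
   changes a combination by constants only. *)
Definition block_relation (y : T * T) (z : block_index + T) : F :=
  match z with
  | inl p => ((val p).1 == y)%:R
  | inr k => - block_total y k
  end.

Lemma combination_block_relation y i w : y \in blocks ->
  combination (block_relation y) i w = 0.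
Proof.
move=> yB; rewrite /combination big_sumType /= (bigD1 i) //= eqxx mulr1.
rewrite [X in _ + (_ + X)]big1 ?addr0; last first.
  by move=> k /negPf ki; rewrite eq_sym ki mulr0.
rewrite -(sum_block_spline i w yB) [X in X - _ = _](bigID (fun p => (val p).1 == y)) /=.
rewrite [X in _ + X - _]big1 ?addr0; last by move=> p /negPf ->; rewrite mul0r.
by rewrite -sumrB big1 // => p /eqP py; rewrite py eqxx mul1r subrr.
Qed.

(** Without jumps, the coefficient of (y, w(A)) as a function of w is invariant under ([y.1],[y.2]),
    besides the transpositions inside A and inside its complement. These generate the symmetric
    group, so the coefficients at y are constant. After subtraction of block relations only the x_k
    remain, and they are independent. *)
Lemma combination_eq0 c : (forall i w, combination c i w = 0) ->
  exists d : T * T -> F,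
    forall z, c z = \sum_(y in blocks) d y * block_relation y z.
Proof.
move=> c0.
have const y (w w' : {perm T}) : y \in blocks ->
    block_coef c y (w @: block_side y) = block_coef c y (w' @: block_side y).
  move=> yB; pose f (v : {perm T}) := block_coef c y (v @: block_side y).
  apply: (@swap_invariant_const _ _ f w w').
  pose r := [rel u v | ((u \in block_side y) == (v \in block_side y))
    || ((u == y.1) && (v == y.2))].
  have rP u v : r u v ->
      swap_invariant f u v.
    case/orP => [/eqP uv|/andP[/eqP -> /eqP ->]] v'.
      by rewrite /f imset_permM imset_tperm_id.
    apply/esym/eqP; rewrite -subr_eq0 -jump_combination //.
    by rewrite /jump !c0 subrr.
  have inv12 : swap_invariant f y.1 y.2.
    by apply: rP; rewrite /r /= !eqxx orbT.
  have inv_eq u v : (u \in block_side y) = (v \in block_side y) ->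
      swap_invariant f u v.
    by move=> uv; apply: rP; rewrite /r /= uv eqxx.
  have y1 := fst_block_side yB; have /negPf y2 := snd_block_side yB.
  have inv1 u : swap_invariant f u y.1.
    case: (boolP (u \in block_side y)) => uy; first by apply: inv_eq; rewrite uy y1.
    apply: (swap_invariant_trans _ (swap_invariant_sym inv12)).
    by apply: inv_eq; rewrite (negPf uy) y2.
  move=> u v; exact: swap_invariant_trans (inv1 u) (swap_invariant_sym (inv1 v)).
exists (fun y => block_coef c y (block_side y)).
have cl p : c (inl p) = \sum_(y in blocks)
    block_coef c y (block_side y) * block_relation y (inl p).
  have [yB pS] := block_indexP p.
  rewrite (bigD1 (val p).1) //= eqxx mulr1 big1 ?addr0; last first.
    by move=> y /andP[_ /negPf yp]; rewrite eq_sym yp mulr0.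
  have [w wE] := perm_imset_exists (esym pS).
  by rewrite -block_coef_val -wE (const _ w 1%g) // imset_perm1.
case=> [//|k].
pose c' z := c z - \sum_(y in blocks) block_coef c y (block_side y) * block_relation y z.
have c'0 i w : combination c' i w = 0.
  rewrite /combination /c'; under eq_bigr do rewrite mulrBl mulr_suml.
  rewrite sumrB -[X in X - _]/(combination c i w) c0 exchange_big /= big1 ?subr0 //.
  move=> y yB; under eq_bigr do rewrite -mulrA; rewrite -mulr_sumr.
  by rewrite -/(combination _ _ _) combination_block_relation ?mulr0.
have := c'0 k 1%g; rewrite /combination big_sumType /= big1 ?add0r; last first.
  by move=> p _; rewrite /c' -cl subrr mul0r.
rewrite (bigD1 k) //= eqxx mulr1 big1 ?addr0; last first.
  by move=> i /negPf ik; rewrite eq_sym ik mulr0.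
by move/eqP; rewrite subr_eq0 => /eqP.
Qed.

Lemma combination_sum (J : finType) (P : pred J) (d : J -> F)
    (M : J -> block_index + T -> F) i w :
  combination (fun z => \sum_(j | P j) d j * M j z) i w
  = \sum_(j | P j) d j * combination (M j) i w.
Proof.
rewrite /combination; under eq_bigr do rewrite mulr_suml.
rewrite exchange_big; apply: eq_bigr => j _ /=; rewrite mulr_sumr.
by apply: eq_bigr => z _; rewrite mulrA.
Qed.

Section Relations.
Variables (M : T -> block_index + T -> F) (m : T -> T -> {perm T} -> F).
Hypothesis Mm : forall k i w, combination (M k) i w = m k i w.

Definition relation (j : blockT + T) : block_index + T -> F :=
  match j with inl y => block_relation (val y) | inr k => M k end.

Lemma combination_relation (d : blockT + T -> F) i w :
  combination (fun z => \sum_j d j * relation j z) i w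
  = \sum_k d (inr k) * m k i w.
Proof.
rewrite combination_sum big_sumType /= big1 ?add0r.
  by apply: eq_bigr => k _; rewrite Mm.
by move=> [y yB] _ /=; rewrite combination_block_relation ?mulr0.
Qed.

Lemma combination_ker c :
  (exists e, forall i w, combination c i w = \sum_k e k * m k i w) <->
  exists d, forall z, c z = \sum_j d j * relation j z.
Proof.
split=> [[e eP]|[d dP]]; last first.
  exists (fun k => d (inr k)) => i w; rewrite -combination_relation.
  by apply: eq_bigr => z _; rewrite dP.
have [|d dP] := @combination_eq0 (fun z => c z - \sum_k e k * M k z).
  move=> i w; rewrite /combination; under eq_bigr do rewrite mulrBl.
  rewrite sumrB -/(combination c i w) eP.
  rewrite -/(combination (fun z => \sum_k e k * M k z) i w) combination_sum.
  by under [X in _ - X]eq_bigr do rewrite Mm; rewrite subrr.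
exists (fun j => match j with inl y => d (val y) | inr k => e k end) => z.
rewrite big_sumType /= -(big_sub _ (fun y => d y * block_relation y z)) -dP.
by rewrite subrK.
Qed.

(** Block relations give the zero spline, so independence of the m k kills the coefficients of the M
    k. Each block relation is then detected at the index (y, [block_side y]), where those of the
    other blocks vanish. *)
Lemma relation_free (d : blockT + T -> F) :
  (forall e : T -> F, (forall i w, \sum_k e k * m k i w = 0) -> forall k, e k = 0) ->
  (forall z, \sum_j d j * relation j z = 0) -> forall j, d j = 0.
Proof.
move=> m_free d0.
have dr k : d (inr k) = 0.
  apply: (m_free (fun k => d (inr k))) => i w; rewrite -combination_relation.
  by rewrite /combination big1 // => z _; rewrite d0 mul0r.
case=> [[y yB]|//].
have ok : ((y, block_side y).1 \in blocks)
    && (#|(y, block_side y).2| == #|block_side (y, block_side y).1|).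
  by rewrite /= yB eqxx.
have := d0 (inl (Sub (y, block_side y) ok : block_index)).
rewrite big_sumType /= [X in _ + X]big1 ?addr0; last by move=> k _; rewrite dr mul0r.
rewrite (bigD1 (Sub y yB : blockT)) //= eqxx mulr1 big1 ?addr0 //.
move=> [z zB] zy; rewrite /= (_ : (y == z) = false) ?mulr0 //.
by apply: contraNF zy => /eqP e; apply/eqP/val_inj; rewrite /= -e.
Qed.

End Relations.

(** * The classes x_k and t_k in terms of the generators *)

Definition xbar_coef (k : T) (z : block_index + T) : F := (z == inr k)%:R.

Lemma combination_xbar k i w : combination (xbar_coef k) i w = (i == k)%:R.
Proof.
rewrite /combination (bigD1 (inr k)) //= /xbar_coef eqxx mul1r big1 ?addr0 //.
by move=> z /negPf ->; rewrite mul0r.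
Qed.

(** The jump of t_k along y is [w y.1 = k] - [w y.2 = k], with potential S |-> [k in S]: hence the
    coefficients at (y, S). The coefficients of the x_i restore the constants, as computed in
    [tbar_block] and [combination_tbar]. *)
Definition tbar_coef (k : T) (z : block_index + T) : F :=
  match z with
  | inl p => (k \in (val p).2)%:R
  | inr i => 1 - \sum_(y in blocks) (bridge y && (y.1 == i))%:R
  end.

(** At the ends of a bridge the two sides are complementary, which produces the constant at [y.1];
    at any other vertex both the spline and the side of a bridge vanish. For other blocks only S =
    {k} contributes. *)
Lemma tbar_block y k i w : y \in blocks ->
  \sum_(p : block_index | (val p).1 == y)
    (k \in (val p).2)%:R * block_spline y (val p).2 i w
  = (bridge y && (y.1 == i))%:R - (k \in w @: side y i)%:R.
Proof.
move=> yB; case: (boolP (bridge y)) => yb /=.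
  have y12 := adj_neq adj_irr (block_adj yB).
  under eq_bigr do rewrite /block_spline yb mulrA.
  have := sum_block_index (fun z => if z is inl p then (k \in (val p).2)%:R
    * ((i == y.1)%:R - (i == y.2)%:R) else 0) w yB.
  move=> /= ->; rewrite /block_coef; case: insubP => [p _ pE|]; last first.
    by rewrite /= yB card_imset ?eqxx //; apply: perm_inj.
  rewrite pE /= /block_side yb -[k](permKV w) !(mem_imset _ _ perm_inj).
  set x := (w^-1)%g k.
  case: (eqVneq i y.1) => [->|i1].
    rewrite (negPf y12) subr0 mulr1 bridge_sideC //.
    by case: (x \in _); rewrite ?subrr ?subr0.
  rewrite !sub0r.
  case: (eqVneq i y.2) => [->|i2]; first by rewrite mulrN1.
  rewrite oppr0 mulr0 (_ : x \in side y i = false) ?oppr0 //.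
  apply: contraTF yb; rewrite inE => /existsP[j /and3P[ij /eqP yE _]].
  apply/negP => yb.
  have := bridge_block adj_sym adj_irr adj_conn yB yb ij yE.
  by case=> e; [move: i1 | move: i2]; rewrite -e eqxx.
rewrite sub0r.
have sizeE (S : {set T}) : (#|S| == #|block_side y|) = (#|S| == 1%N).
  by rewrite /block_side (negPf yb) cards1.
have ok : ((y, [set k]).1 \in blocks)
    && (#|(y, [set k]).2| == #|block_side (y, [set k]).1|).
  by rewrite /= yB sizeE cards1.
rewrite (bigD1 (Sub (y, [set k]) ok : block_index)) ?SubK //=.
rewrite set11 mul1r /block_spline (negPf yb) sub1set big1 ?addr0 //.
move=> p /andP[/eqP py pk]; have [pB /eqP] := block_indexP p.
rewrite py sizeE => /cards1P[r rE].
rewrite rE inE (_ : (k == r) = false) ?mul0r //; apply: contraNF pk => /eqP kr.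
by apply/eqP/val_inj; rewrite SubK [val p]surjective_pairing py rE kr.
Qed.

Lemma sum_side i x : \sum_(y in blocks) (x \in side y i)%:R = (x != i)%:R :> F.
Proof.
case: (eqVneq x i) => [->|xi].
  by rewrite big1 // => y _; rewrite (negPf (notin_side adj_irr _ _)).
have [y yB xy] := side_exists adj_sym adj_irr adj_conn xi.
rewrite (bigD1 y) //= xy big1 ?addr0 // => z /andP[_ zy].
by case: (boolP (x \in side z i)) => // /(side_inj adj_sym xy) e; rewrite e eqxx in zy.
Qed.

(** After the bridge constants cancel, 1 minus the indicators of w^-1 k in the sides at i is left.
    The sides partition the vertices other than i, so this is the indicator of w^-1 k = i. *)
Lemma combination_tbar k i w : combination (tbar_coef k) i w = (w i == k)%:R.
Proof.
rewrite /combination big_sumType /= [X in _ + X](bigD1 i) //= eqxx mulr1.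
rewrite [X in _ + (_ + X)]big1 ?addr0; last first.
  by move=> j /negPf ji; rewrite eq_sym ji mulr0.
rewrite (partition_big (fun p : block_index => (val p).1) (mem blocks)) /=; last first.
  by move=> p _; have [] := block_indexP p.
rewrite (eq_bigr (fun y => (bridge y && (y.1 == i))%:R - (k \in w @: side y i)%:R)).
  rewrite sumrB (eq_bigr (fun y => ((w^-1)%g k \in side y i)%:R)
    (F1 := fun y => (k \in w @: side y i)%:R)).
    rewrite sum_side addrC addrA subrK.
    rewrite -(inj_eq (@perm_inj _ w)) permKV eq_sym.
    by case: (w i == k); rewrite ?subr0 ?subrr.
  by move=> y _; rewrite -{1}[k](permKV w) (mem_imset _ _ perm_inj).
by move=> y yB; rewrite -tbar_block //; apply: eq_bigr => p /eqP <-.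
Qed.

End LinearSplines.

(** * Splines as polynomial-valued functions *)

Section LinearPart.
Variables (F : fieldType) (n : nat).
Implicit Types (p q : {mpoly F[n]}).

(** Linear coefficients are values at 0 of partial derivatives, so of q only the constant term
    counts. This turns divisibility into conditions on scalars. *)
Lemma mcoeffU_mulX q a c : (q * 'X_a)@_U_(c) = q@_0%MM * (a == c)%:R.
Proof.
have derE p : p@_U_(c) = (p^`M(c))@_0%MM.
  by rewrite mcoeff_mderiv add0m mnm0E.
rewrite derE mderivM mderivX mnm1E mcoeffD !rmorphM /= mcoeffX.
rewrite (_ : (U_(a)%MM == 0%MM) = false) ?mulr0 ?add0r; last first.
  by apply/negbTE; rewrite -mdeg_eq0 mdeg1.
rewrite mcoeffZ mcoeffX; case: eqP => [->|_]; last by rewrite mul0r.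
rewrite mul1r (_ : (U_(c) - U_(c))%MM = 0%MM) ?eqxx //; apply/mnmP => i.
by rewrite mnmBE subnn mnm0E.
Qed.

Lemma homog1E p : p \is 1.-homog -> p = \sum_i p@_U_(i) *: 'X_i.
Proof.
move=> ph; apply/mpolyP => m; rewrite raddf_sum /=.
have [/existsP[j /eqP ->]|m1] := boolP [exists i : 'I_n, m == U_(i)%MM].
  rewrite (bigD1 j) //= mcoeffZ mcoeffXU eqxx mulr1 big1 ?addr0 // => i ij.
  by rewrite mcoeffZ mcoeffXU (negPf ij) mulr0.
rewrite -mdeg_eq1 in m1; rewrite (dhomog_nemf_coeff ph m1) big1 // => i _.
rewrite mcoeffZ mcoeffX (_ : (_ == m) = false) ?mulr0 //.
by apply: contraNF m1 => /eqP <-; rewrite mdeg1.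
Qed.

Lemma homog_linear (c : 'I_n -> F) (h : 'I_n -> 'I_n) :
  \sum_i c i *: ('X_(h i) : {mpoly F[n]}) \is 1.-homog.
Proof. by apply: rpred_sum => i _; apply: rpredZ; rewrite dhomogX /= mdeg1. Qed.

End LinearPart.

Section SplineModel.
Variables (F : fieldType) (n : nat) (G : graph 'I_n).
Hypothesis G_full : G.1 = [set: 'I_n].
Hypothesis G_simple : simple_graph G.
Hypothesis G_conn : connected_graph G.

Local Notation adj := (adjacent G).
Local Notation spline_fun := {ffun 'S_n -> {mpoly F[n]}}.

Lemma adjacent_sym : ssrbool.symmetric adj.
Proof. by move=> i j; rewrite /adjacent setUC. Qed.

Lemma adjacent_irr : irreflexive adj.
Proof.
move=> i; apply/negbTE/negP => ii; move/forall_inP/(_ _ ii): G_simple.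
by rewrite setUid cards1.
Qed.

Lemma adjacent_connect i j : connect adj i j.
Proof.
have /andP[_ /forall_inP/(_ i)] := G_conn; rewrite G_full inE => /(_ isT).
by move/forall_inP/(_ j); rewrite inE => /(_ isT).
Qed.

Definition spline_of (sg : 'I_n -> 'S_n -> F) : spline_fun :=
  [ffun v : 'S_n => \sum_i sg i v *: 'X_(v i)].

Lemma spline_of_coef sg i (v : 'S_n) : (spline_of sg v)@_U_(v i) = sg i v.
Proof.
rewrite ffunE raddf_sum (bigD1 i) //= mcoeffZ mcoeffXU eqxx mulr1 big1 ?addr0 //.
by move=> j /negPf ji; rewrite mcoeffZ mcoeffXU (inj_eq perm_inj) ji mulr0.
Qed.

Lemma eq_spline_of sg sg' : (forall i v, sg i v = sg' i v) ->
  spline_of sg = spline_of sg'.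
Proof.
by move=> e; apply/ffunP => v; rewrite !ffunE; apply: eq_bigr => i _; rewrite e.
Qed.

Lemma spline_of_homog sg v : spline_of sg v \is 1.-homog.
Proof. by rewrite ffunE homog_linear. Qed.

Lemma homog_spline_of (rho : spline_fun) : (forall v, rho v \is 1.-homog) ->
  rho = spline_of (fun i v => (rho v)@_U_(v i)).
Proof.
move=> rhoh; apply/ffunP => v; rewrite ffunE {1}(homog1E (rhoh v)).
by rewrite (reindex_inj (@perm_inj _ v)).
Qed.

Lemma spline_of_linear sg : linear_spline adj sg -> spline_degree G 1 (spline_of sg).
Proof.
move=> sgP; split=> [w i j ij|v]; last exact: spline_of_homog.
have [inv1 inv2] := sgP i j ij; have ij' := adj_neq adjacent_irr ij.
(* At the swapped permutation t_(w i) sits in position j, so this is the coefficient of t_(w i) in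
   the difference; that of t_(w j) is its opposite by the invariance of sg i + sg j. *)
exists (sg i w - sg j (tperm i j * w)%g)%:MP.
rewrite !ffunE [in X in _ - X](reindex_inj (@perm_inj _ (tperm i j))) -sumrB.
rewrite (bigD1 i) //= (bigD1 j) 1?eq_sym //= big1 ?addr0; last first.
  move=> k /andP[ki kj]; rewrite !permM tpermK tpermD 1?eq_sym //.
  by rewrite inv1 // subrr.
rewrite !permM !tpermK tpermL tpermR -!scalerBl mul_mpolyC scalerBr -scaleNr.
congr (_ + _ *: _); have /= e := inv2 w.
by apply/eqP; rewrite opprB subr_eq addrAC eq_sym subr_eq addrC e addrC.
Qed.

Lemma linear_spline_coef (rho : spline_fun) : is_spline G rho ->
  linear_spline adj (fun i v => (rho v)@_U_(v i)).
Proof.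
move=> rhoP i j ij; have ij' := adj_neq adjacent_irr ij.
have coefE (w : 'S_n) k : (rho w)@_U_(w k) - (rho (tperm i j * w)%g)@_U_(w k)
    = (rho w - rho (tperm i j * w)%g)@_U_(w k) by rewrite mcoeffB.
split=> [k ki kj|] w; have [q qE] := rhoP w i j ij.
  have kfix : tperm i j k = k by rewrite tpermD // eq_sym.
  apply/esym/eqP; rewrite permM kfix -subr_eq0 coefE qE.
  rewrite mulrBr mcoeffB !mcoeffU_mulX !(inj_eq perm_inj).
  by rewrite ![_ == k]eq_sym (negPf ki) (negPf kj) mulr0 subrr.
rewrite /= !permM tpermL tpermR; apply/esym/eqP; rewrite -subr_eq0.
rewrite [X in _ - X]addrC opprD addrACA !coefE qE.
rewrite mulrBr !mcoeffB !mcoeffU_mulX !(inj_eq perm_inj) !eqxx.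
by rewrite [j == i]eq_sym (negPf ij') !mulr0 !mulr1 subr0 sub0r subrr.
Qed.

Lemma spline_const (c : spline_fun) (v w : 'S_n) : is_spline G c ->
  (c v)@_0%MM = (c w)@_0%MM.
Proof.
move=> cP; apply: (swap_invariant_const (f := fun v => (c v)@_0%MM)) => i j.
apply: (swap_invariant_connect _ (adjacent_connect i j)) => k l kl u.
have [q] := cP u k l kl; move/(congr1 (mcoeff 0%MM)).
rewrite mcoeffB rmorphM /= mcoeffB !mcoeffX -!mdeg_eq0 !mdeg1 subrr mulr0.
by move/eqP; rewrite subr_eq0 => /eqP.
Qed.

Lemma spline_scalar (a : F) : is_spline G [ffun=> a%:MP].
Proof. by move=> w i j _; exists 0; rewrite !ffunE subrr mul0r. Qed.

Lemma spline_mulE (f g : spline_fun) v : (f * g) v = f v * g v.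
Proof. exact: ffunE. Qed.

(** In degree 1 only the constant terms of the multipliers count, and those of a spline are the same
    at every w; so the ideal meets degree 1 in the linear span of its generators. *)
Lemma spline_ideal_degree1 (h : 'I_n -> 'S_n -> 'I_n) sg :
  spline_ideal G (fun k => [ffun w : 'S_n => 'X_(h k w)]) (spline_of sg) <->
  exists e, forall i w, sg i w = \sum_k e k * (w i == h k w)%:R.
Proof.
split=> [[c [cP cE]]|[e eP]].
  exists (fun k => (c k 1%g)@_0%MM) => i w; rewrite -spline_of_coef cE.
  rewrite sum_ffunE raddf_sum; apply: eq_bigr => k _.
  rewrite spline_mulE ffunE mulrC /= mcoeffU_mulX (spline_const w 1%g (cP k)).
  by rewrite eq_sym.
exists (fun k => [ffun=> (e k)%:MP]); split=> [k|]; first exact: spline_scalar.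
apply/ffunP => w; rewrite ffunE sum_ffunE.
under eq_bigr do rewrite eP scaler_suml.
rewrite exchange_big; apply: eq_bigr => k _ /=.
rewrite spline_mulE !ffunE mulrC mul_mpolyC (bigD1 ((w^-1)%g (h k w))) //= permKV eqxx mulr1.
rewrite big1 ?addr0 // => i ik; rewrite (_ : (w i == h k w) = false) ?mulr0 ?scale0r //.
by apply: contraNF ik => /eqP <-; rewrite permK.
Qed.

Lemma act_polyX (w : 'S_n) k : act_poly w ('X_k : {mpoly F[n]}) = 'X_(w k).
Proof. by rewrite /act_poly comp_mpolyXU -tnth_nth tnth_mktuple. Qed.

Lemma dot_action_spline_of sg w :
  dot_action w (spline_of sg) = spline_of (fun i v => sg i (v * w^-1)%g).
Proof.
apply/ffunP => v; rewrite !ffunE /act_poly raddf_sum /=; apply: eq_bigr => i _.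
by rewrite linearZ /= -/(act_poly _ _) act_polyX permM permKV.
Qed.

Lemma dot_action_linear w a (u v : spline_fun) :
  dot_action w (a *: u + v) = a *: dot_action w u + dot_action w v.
Proof.
by apply/ffunP => x; rewrite !ffunE /act_poly linearP.
Qed.

Lemma dot_action_is_spline w (c : spline_fun) :
  is_spline G c -> is_spline G (dot_action w c).
Proof.
move=> cP v i j ij; have [q qE] := cP (v * w^-1)%g i j ij.
exists (act_poly w q); rewrite !ffunE -mulgA /act_poly -comp_mpolyB qE rmorphM /= comp_mpolyB.
by rewrite -!/(act_poly _ _) !act_polyX !permM !permKV.
Qed.

Lemma dot_action_ideal (g : 'I_n -> spline_fun) (s : 'S_n) w u :
  (forall k, dot_action w (g k) = g (s k)) ->
  spline_ideal G g u -> spline_ideal G g (dot_action w u).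
Proof.
move=> gs [c [cP ->]]; exists (fun k => dot_action w (c ((s^-1)%g k))).
split=> [k|]; first exact: dot_action_is_spline.
rewrite [RHS](reindex_inj (@perm_inj _ s)) /=; apply/ffunP => v.
rewrite ffunE !sum_ffunE /act_poly raddf_sum; apply: eq_bigr => k _.
by rewrite permK -gs !spline_mulE !ffunE /= rmorphM.
Qed.

Lemma spline_idealP (g : 'I_n -> spline_fun) a u v :
  spline_ideal G g u -> spline_ideal G g v -> spline_ideal G g (a *: u + v).
Proof.
move=> [c [cP ->]] [d [dP ->]]; exists (fun k => a *: c k + d k); split=> [k|].
  move=> w i j ij; have [q qE] := cP k w i j ij; have [r rE] := dP k w i j ij.
  exists (a *: q + r); rewrite !ffunE opprD addrACA -scalerBr qE rE.
  by rewrite mulrDl scalerAl.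
rewrite scaler_sumr -big_split; apply: eq_bigr => k _ /=; apply/ffunP => x.
by rewrite !(ffunE, spline_mulE) mulrDr scalerAr.
Qed.

Lemma spline_ideal0 (g : 'I_n -> spline_fun) : spline_ideal G g 0.
Proof.
exists (fun=> 0); split=> [k w i j _|]; first by exists 0; rewrite !ffunE subrr mul0r.
by rewrite big1 // => k _; rewrite mulr0.
Qed.

Lemma spline_degreeP a (u v : spline_fun) :
  spline_degree G 1 u -> spline_degree G 1 v -> spline_degree G 1 (a *: u + v).
Proof.
move=> [uP uh] [vP vh]; split=> [w i j ij|w].
  have [q qE] := uP w i j ij; have [r rE] := vP w i j ij.
  exists (a *: q + r); rewrite !ffunE opprD addrACA -scalerBr qE rE.
  by rewrite mulrDl scalerAl.
by rewrite !ffunE rpredD // rpredZ.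
Qed.

Lemma spline_degree0 : spline_degree G 1 (0 : spline_fun).
Proof.
split=> [w i j _|w]; first by exists 0; rewrite !ffunE subrr mul0r.
by rewrite ffunE rpred0.
Qed.

End SplineModel.

(** * Characters in degree 1 *)

Section SubsetCount.
Variable T : finType.
Implicit Types w : {perm T}.

Definition fixed_subsets (a : nat) (w : {perm T}) : nat :=
  #|[set S : {set T} | (#|S| == a) && (w @: S == S)]|.

Lemma fixed_subsets1 w : fixed_subsets 1 w = #|[set k | w k == k]|.
Proof.
rewrite -(card_imset _ (@set1_inj T)) /fixed_subsets; apply: eq_card => S.
rewrite inE; apply/andP/imsetP => [[/cards1P[k ->]]|[k]].
  by rewrite imset_set1 => /eqP/set1_inj wk; exists k; rewrite ?inE ?wk.
by rewrite inE => /eqP wk ->; rewrite cards1 imset_set1 wk.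
Qed.

End SubsetCount.

Section IndexAction.
Variables (F : fieldType) (T : finType) (adj : rel T).
Local Notation blocks := (blocks adj).
Local Notation block_side := (block_side adj).
Local Notation block_index := (block_index adj).
Implicit Types w : {perm T}.

Lemma index_act_subproof (w : {perm T}) (p : block_index) :
  ((val p).1 \in blocks) && (#|w @: (val p).2| == #|block_side (val p).1|).
Proof.
by have [-> <-] := block_indexP p; rewrite card_imset ?eqxx //; apply: perm_inj.
Qed.

Definition block_act w (p : block_index) : block_index :=
  Sub ((val p).1, w @: (val p).2) (index_act_subproof w p).

(** The dot action on the generators: translation by w moves S to w(S) and fixes what is constant in
    position coordinates. *)
Definition index_act w (z : block_index + T) : block_index + T :=
  match z with inl p => inl (block_act w p) | inr k => inr k end.

Lemma index_act_inj w : injective (index_act w).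
Proof.
move=> [p|k] [q|l] //= [] // e e'; congr (inl _); apply: val_inj.
rewrite [val p]surjective_pairing [val q]surjective_pairing.
by rewrite e; congr (_, _); apply: imset_inj e'; apply: perm_inj.
Qed.

Lemma basis_spline_act w z i (v : {perm T}) :
  basis_spline F z i (v * w^-1)%g = basis_spline F (index_act w z) i v.
Proof.
case: z => [p|k] //=; rewrite /block_spline.
have imsetK (X : {set T}) : w^-1%g @: (w @: X) = X.
  by rewrite -imset_permM mulgV imset_perm1.
have act_eq (X S : {set T}) : ((v * w^-1)%g @: X == S) = (v @: X == w @: S).
  rewrite imset_permM -{1}[S]imsetK.
  by apply/eqP/eqP => [/(imset_inj perm_inj)|->].
have act_sub (X S : {set T}) : (S \subset (v * w^-1)%g @: X) = (w @: S \subset v @: X).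
  apply/idP/idP => [/(imsetS w)|/(imsetS w^-1%g)]; last by rewrite imsetK imset_permM.
  by rewrite -imset_permM mulgKV.
by rewrite act_eq act_sub.
Qed.

Lemma card_fixed_index w :
  #|[set z | index_act w z == z]|
  = (\sum_(y in blocks) fixed_subsets #|block_side y| w + #|T|)%N.
Proof.
rewrite -sum1_card big_sumType /=; congr (_ + _)%N; last first.
  by rewrite (eq_bigl predT) ?sum1_card // => k; rewrite inE eqxx.
rewrite (partition_big (fun p : block_index => (val p).1) (mem blocks)) /=; last first.
  by move=> p _; have [] := block_indexP p.
apply: eq_bigr => y yB; rewrite sum1_card /fixed_subsets.
rewrite -(card_in_imset (f := fun p : block_index => (val p).2)); last first.
  move=> p q /andP[_ /eqP py] /andP[_ /eqP qy] e; apply: val_inj.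
  by rewrite [val p]surjective_pairing [val q]surjective_pairing py qy e.
apply: eq_card => S; rewrite !inE; apply/imsetP/andP.
  case=> p /andP[]; rewrite inE => /eqP[pE] /eqP py ->.
  have [_ pS] := block_indexP p; rewrite pS py eqxx; split=> //.
  by rewrite -{2}pE.
case=> Sa /eqP wS.
have ok : ((y, S).1 \in blocks) && (#|(y, S).2| == #|block_side (y, S).1|).
  by rewrite /= yB.
exists (Sub (y, S) ok : block_index) => //.
apply/andP; rewrite inE eqxx; split=> //; apply/eqP; congr inl.
by apply: val_inj; rewrite /= wS.
Qed.

End IndexAction.

Section Characters.
Variables (F : fieldType) (n : nat) (G : graph 'I_n).
Hypothesis G_full : G.1 = [set: 'I_n].
Hypothesis G_simple : simple_graph G.
Hypothesis G_conn : connected_graph G.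

Local Notation adj := (adjacent G).
Local Notation adj_sym := (adjacent_sym G).
Local Notation adj_irr := (adjacent_irr G_simple).
Local Notation adj_conn := (adjacent_connect G_full G_conn).
Local Notation spline_fun := {ffun 'S_n -> {mpoly F[n]}}.
Local Notation index := (block_index adj + 'I_n)%type.

Lemma spline_of_combination (c : index -> F) :
  spline_of (combination c) = \sum_z c z *: spline_of (basis_spline F z).
Proof.
apply/ffunP => v; rewrite ffunE sum_ffunE /combination.
under eq_bigr do rewrite scaler_suml.
rewrite exchange_big; apply: eq_bigr => z _ /=; rewrite !ffunE scaler_sumr.
by apply: eq_bigr => i _; rewrite scalerA.
Qed.

(* The case h k v = k is that of the ideal of the t_k, permuted by w, and
   h k v = v k that of the ideal of the x_k, fixed by w. *)
Lemma quotient_trace_count (h : 'I_n -> 'S_n -> 'I_n)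
    (M : 'I_n -> index -> F) (s w : 'S_n) :
    (forall k i (v : 'S_n), combination (M k) i v = (v i == h k v)%:R) ->
    (forall e : 'I_n -> F, (forall i (v : 'S_n), \sum_k e k * (v i == h k v)%:R = 0) ->
      forall k, e k = 0) ->
    (forall k (v : 'S_n), w (h k (v * w^-1)%g) = h (s k) v) ->
    (forall k z, M (s k) (index_act w z) = M k z) ->
  quotient_trace (spline_degree G 1)
    (spline_ideal G (fun k => [ffun v : 'S_n => 'X_(h k v)])) (dot_action w)
  = \sum_(y in blocks adj) (fixed_subsets #|block_side adj y| w)%:R
    + n%:R - (#|blocks adj| + #|[set k | s k == k]|)%:R :> F.
Proof.
move=> Mh h_free hs Ms.
pose rel := @relation F 'I_n adj M.
pose q (j : blockT adj + 'I_n) := match j with inl y => inl y | inr k => inr (s k) end.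
rewrite (quotient_trace_perm _ _ _ _ _ _ (K := rel) (p := index_act w) (q := q)
  (B := fun z : index => spline_of (basis_spline F z))).
- rewrite card_fixed_index card_ord natrD natr_sum; congr (_ - _%:R).
  rewrite -sum1_card big_sumType /=; congr (_ + _)%N.
    rewrite (eq_bigl predT) ?sum1_card ?card_sig //; last by move=> y; rewrite inE eqxx.
  by rewrite -sum1_card; apply: eq_bigl => k; rewrite !inE.
- exact: spline_ideal0.
- by move=> a u v; apply: spline_idealP.
- by move=> a u v; apply: dot_action_linear.
- move=> u; apply: (dot_action_ideal (s := s)) => k; apply/ffunP => v.
  by rewrite !ffunE act_polyX hs.
- exact: spline_degree0.
- by move=> a u v; apply: spline_degreeP.
- exact: index_act_inj.
- move=> z; apply: (spline_of_linear G_simple).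
  exact: basis_spline_linear adj_sym adj_irr adj_conn _.
- move=> u [uP uh]; have := linear_spline_coef G_simple uP.
  case/(combination_surj adj_sym adj_irr adj_conn) => c cE; exists c.
  rewrite -spline_of_combination (homog_spline_of uh) (eq_spline_of cE) subrr.
  exact: spline_ideal0.
- move=> c; rewrite -spline_of_combination spline_ideal_degree1 //.
  exact: (combination_ker adj_sym adj_irr adj_conn Mh).
- by move=> d; apply: (relation_free Mh).
- move=> z; rewrite dot_action_spline_of; apply: eq_spline_of => i v.
  exact: basis_spline_act.
- by move=> [y|k] [p|l] //=; [apply: (Ms k (inl p)) | apply: (Ms k (inr l))].
Qed.

(** The relations x_k are fixed by w, so s = 1 and they cancel the n generators [inr k]. *)
Lemma R_characterE w : R_character F G 1 w =
  \sum_(y in blocks adj) (fixed_subsets #|block_side adj y| w)%:R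
  - #|blocks adj|%:R :> F.
Proof.
rewrite /R_character /xbar.
rewrite (@quotient_trace_count (fun k v => v k) (@xbar_coef F 'I_n adj) 1%g).
- rewrite natrD opprD addrA addrAC; congr (_ - _).
  rewrite (_ : #|_| = n) ?addrK // -[RHS]card_ord; apply: eq_card => k.
  by rewrite !inE perm1 eqxx.
- by move=> k i v; rewrite combination_xbar (inj_eq perm_inj).
- move=> e e0 k; rewrite -[RHS](e0 k 1%g) (bigD1 k) //= eqxx mulr1 big1 ?addr0 //.
  by move=> l lk; rewrite !perm1 eq_sym (negPf lk) mulr0.
- by move=> k v; rewrite permM permKV perm1.
- by move=> k [p|l]; rewrite perm1.
Qed.

(** The relations t_k are permuted like the points, so s = w and the fixed points of w are
    subtracted, while the n generators [inr k] still count. *)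
Lemma L_characterE w : L_character F G 1 w =
  \sum_(y in blocks adj) (fixed_subsets #|block_side adj y| w)%:R
  + n%:R - #|blocks adj|%:R - (fixed_subsets 1 w)%:R :> F.
Proof.
rewrite /L_character /tbar.
rewrite (@quotient_trace_count (fun k _ => k) (@tbar_coef F 'I_n adj) w).
- by rewrite natrD opprD addrA fixed_subsets1.
- by move=> k i v; rewrite (combination_tbar _ adj_sym adj_irr adj_conn).
- move=> e e0 k; rewrite -[RHS](e0 k 1%g) (bigD1 k) //= perm1 eqxx mulr1 big1 ?addr0 //.
  by move=> l lk; rewrite eq_sym (negPf lk) mulr0.
- by [].
- by move=> k [p|l] //=; rewrite (mem_imset _ _ perm_inj).
Qed.

End Characters.

(** * Symmetric functions *)

Section Frobenius.
Variables (F : fieldType) (n N : nat).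
Local Notation mpoly := {mpoly F[N]}.

(** Expanding the product assigns a variable to each cycle of w, that is, a map on 'I_n constant on
    the cycles. *)
Lemma prod_power_sum (w : 'S_n) :
  \prod_(c in porbits w) power_sum F N #|c|
  = \sum_(g : {ffun 'I_n -> 'I_N} | [forall i, g (w i) == g i])
      \prod_i 'X_(g i) :> mpoly.
Proof.
pose P := {c in porbits w}.
have /fin_all_exists [rep repP] (c : P) : exists x, porbit w x = val c.
  by have /imsetP[x _ ->] := valP c; exists x.
have orbP x : porbit w x \in porbits w by apply: imset_f.
pose orb x : P := Sub (porbit w x) (orbP x).
rewrite (big_sub _ (fun c : {set _} => power_sum F N #|c|)) bigA_distr_bigA /=.
have inv_orbit (g : {ffun 'I_n -> 'I_N}) x y :
    [forall i, g (w i) == g i] -> x \in porbit w y -> g x = g y.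
  move=> /forallP gw /porbitP[k ->]; elim: k => [|k IH]; first by rewrite expg0 perm1.
  by rewrite expgSr permM (eqP (gw _)).
rewrite (reindex_onto (fun f : {ffun P -> 'I_N} => [ffun x => f (orb x)])
    (fun g : {ffun 'I_n -> 'I_N} => [ffun c => g (rep c)])) /=; last first.
  move=> g gw; apply/ffunP => x; rewrite !ffunE; apply: inv_orbit gw _.
  by rewrite -eq_porbit_mem repP.
apply: eq_big => [f|f _].
  apply/esym/andP; split.
    apply/forallP => i; rewrite !ffunE; apply/eqP; congr (f _); apply: val_inj => /=.
    by have := porbit_perm w 1 i; rewrite expg1.
  apply/eqP/ffunP => c; rewrite !ffunE; congr (f _); apply: val_inj.
  by rewrite /= repP.
rewrite (partition_big orb predT) //=; apply: eq_bigr => c _.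
rewrite (eq_bigl (mem (val c))) => [|i]; last first.
  by rewrite -(inj_eq val_inj) /= -(repP c) eq_porbit_mem.
rewrite (eq_bigr (fun=> 'X_(f c))) ?prodr_const // => i ic.
rewrite ffunE; congr 'X_(f _); apply: val_inj; rewrite SubK -(repP c).
by apply/eqP; rewrite eq_porbit_mem repP.
Qed.

(* A subset of 'I_n, marked by the boolean, together with a map to 'I_N. *)
Local Notation colouring := {ffun 'I_n -> bool * 'I_N}.

Definition recolour (f : colouring) (w : 'S_n) : colouring := [ffun i => f (w i)].

Definition weight (s : seq (bool * 'I_N)) : mpoly := \prod_(x <- s) 'X_(x.2).

Definition colours (f : colouring) : seq (bool * 'I_N) := [seq f i | i <- enum 'I_n].

Definition marked (f : colouring) : nat := count fst (colours f).

Lemma markedE f : marked f = #|[set i | (f i).1]|.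
Proof.
rewrite /marked count_map -sum1_count -sum1_card big_enum_cond /=.
by apply: eq_bigl => i; rewrite inE.
Qed.

Lemma weightE f : weight (colours f) = \prod_i 'X_((f i).2).
Proof. by rewrite /weight big_map big_enum. Qed.

Lemma fixed_subsets_colourings a (w : 'S_n) :
  (fixed_subsets a w)%:R *: (\prod_(c in porbits w) power_sum F N #|c|)
  = \sum_(f : colouring | (marked f == a) && (recolour f w == f)) weight (colours f).
Proof.
rewrite prod_power_sum /fixed_subsets -sum1_card natr_sum scaler_suml.
under eq_bigr do rewrite scale1r.
rewrite pair_big /=.
rewrite (reindex (fun f : colouring => ([set i | (f i).1], [ffun i => (f i).2]))) /=.
  apply: eq_big => [f|f _]; last first.
    by rewrite weightE; apply: eq_bigr => i _; rewrite ffunE.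
  rewrite inE -markedE -andbA; congr (_ && _).
  apply/andP/eqP => [[/eqP fw /forallP gw]|fw].
    apply/ffunP => i; rewrite ffunE [LHS]surjective_pairing [RHS]surjective_pairing.
    congr (_, _); last by have /eqP := gw i; rewrite !ffunE.
    have := mem_imset [set i | (f i).1] i (@perm_inj _ w).
    by rewrite fw !inE.
  have fwi i : f (w i) = f i by rewrite -{2}fw ffunE.
  split; last by apply/forallP => i; rewrite !ffunE fwi.
  apply/eqP/setP => j; rewrite -[j](permKV w) (mem_imset _ _ perm_inj) !inE.
  by rewrite fwi.
exists (fun z : {set 'I_n} * {ffun 'I_n -> 'I_N} => [ffun i => (i \in z.1, z.2 i)]).
  by move=> f _; apply/ffunP => i; rewrite ffunE inE ffunE -surjective_pairing.
move=> [S g] _; congr (_, _); first by apply/setP => i; rewrite inE ffunE.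
by apply/ffunP => i; rewrite !ffunE.
Qed.

Lemma colours_perm (f g : colouring) :
  reflect (exists w, g = recolour f w) (perm_eq (colours g) (colours f)).
Proof.
have fE : colours f = [tuple f i | i < n] by [].
rewrite fE; apply: (iffP tuple_permP) => [[w wE]|[w wE]]; exists w.
  apply/ffunP => i; rewrite ffunE.
  move/(congr1 (nth (g i) ^~ i)): wE.
  by rewrite (nth_map i) ?nth_ord_enum ?size_enum_ord // -tnth_nth !tnth_mktuple.
by rewrite wE /colours; apply: eq_map => i; rewrite ffunE tnth_mktuple.
Qed.

Lemma recolourM f u w : recolour (recolour f u) w = recolour f (w * u)%g.
Proof. by apply/ffunP => i; rewrite !ffunE permM. Qed.

(* Orbit-stabiliser for 'S_n acting on the rearrangements of f. *)
Lemma sum_stabilisers f :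
  \sum_(g | perm_eq (colours g) (colours f)) #|[set w | recolour g w == g]| = n`!.
Proof.
(* For g = [recolour f u], right translation by u maps the stabiliser of g onto the w with
   [recolour f w] = g; over all g these sets partition 'S_n. *)
transitivity (\sum_(g | perm_eq (colours g) (colours f)) #|[set w | recolour f w == g]|).
  apply: eq_bigr => g /colours_perm[u ->].
  rewrite -(card_imset _ (mulIg u)); apply: eq_card => w.
  rewrite !inE; apply/imsetP/eqP => [[v vE ->]|wE].
    by move: vE; rewrite inE recolourM => /eqP.
  by exists (w * u^-1)%g; rewrite ?mulgKV // inE recolourM mulgKV wE.
under eq_bigr do rewrite -sum1_card big_mkcond /=.
rewrite exchange_big /= -card_Sn -sum1_card; apply: eq_big => [w|w _].
  by rewrite inE.
rewrite (bigD1 (recolour f w)) /=; last by apply/colours_perm; exists w.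
rewrite inE eqxx big1 // => g /andP[_ /negPf gw].
by rewrite inE eq_sym gw.
Qed.

Section Words.
Variables a b : nat.
Local Notation pairs := (a.-tuple 'I_N * b.-tuple 'I_N)%type.

(** The normal form of an orbit of colourings with a marked points, which come first. Each orbit has
    exactly one sorted pair, and its weight is one term of h_a h_b. *)
Definition word (z : pairs) : seq (bool * 'I_N) :=
  [seq (true, x) | x <- z.1] ++ [seq (false, x) | x <- z.2].

Definition sorted_pair (z : pairs) : bool :=
  sorted leq (map val z.1) && sorted leq (map val z.2).

Lemma weight_word z :
  weight (word z) = (\prod_(x <- z.1) 'X_x) * (\prod_(x <- z.2) 'X_x).
Proof. by rewrite /weight big_cat !big_map. Qed.

Lemma sum_word :
  \sum_(z | sorted_pair z) weight (word z) = complete_sym F N a * complete_sym F N b.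
Proof.
rewrite /complete_sym big_distrlr pair_big /=; apply: eq_bigr => z _.
exact: weight_word.
Qed.

Lemma filter_word z : [seq x <- word z | x.1] = [seq (true, x) | x <- z.1].
Proof.
rewrite filter_cat !filter_map /= (eq_filter (a2 := predT)) // filter_predT.
by rewrite (eq_filter (a2 := pred0)) // filter_pred0 cats0.
Qed.

Lemma filterC_word z : [seq x <- word z | ~~ x.1] = [seq (false, x) | x <- z.2].
Proof.
rewrite filter_cat !filter_map /= (eq_filter (a2 := pred0)) // filter_pred0.
by rewrite (eq_filter (a2 := predT)) // filter_predT.
Qed.

Lemma count_word z : count fst (word z) = a.
Proof. by rewrite -size_filter filter_word size_map size_tuple. Qed.

Lemma word_inj z z' : sorted_pair z -> sorted_pair z' ->
  perm_eq (word z) (word z') -> z = z'.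
Proof.
move: z z' => [t u] [t' u'] /andP[/= st su] /andP[/= st' su'] e.
have sort_uniq m (s s' : m.-tuple 'I_N) : sorted leq (map val s) ->
    sorted leq (map val s') -> perm_eq s s' -> s = s'.
  move=> ss ss' ps; apply/val_inj/(inj_map val_inj).
  by apply: (sorted_eq leq_trans anti_leq ss ss'); apply: perm_map.
congr (_, _); apply: sort_uniq => //.
  apply: (@perm_map_inj _ _ (pair true)) => [x y []//|].
  by rewrite -(filter_word (t, u)) -(filter_word (t', u')) perm_filter.
apply: (@perm_map_inj _ _ (pair false)) => [x y []//|].
by rewrite -(filterC_word (t, u)) -(filterC_word (t', u')) perm_filter.
Qed.

Hypothesis abn : (a + b)%N = n.

Lemma colours_word z : exists f, colours f = word z.
Proof.
have sz : size (word z) == n by rewrite size_cat !size_map !size_tuple abn.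
exists [ffun i => tnth (Tuple sz) i].
rewrite /colours (eq_map (g := tnth (Tuple sz))) ?map_tnth_enum // => i.
by rewrite ffunE.
Qed.

Lemma word_exists f : marked f = a ->
  exists2 z, sorted_pair z & perm_eq (colours f) (word z).
Proof.
move=> fa; pose s c := sort (fun x y : 'I_N => x <= y)%N
  [seq x.2 | x <- colours f & x.1 == c].
have size1 : size (s true) == a.
  rewrite size_sort size_map size_filter -[X in _ == X]fa; apply/eqP/eq_count.
  by move=> x; rewrite eqb_id.
have size2 : size (s false) == b.
  rewrite size_sort size_map size_filter -(eqn_add2l a) -{1}fa abn /marked.
  rewrite (eq_count (a1 := fun x => x.1 == false) (a2 := predC fst)); last by case=> [[] y].
  by rewrite count_predC size_map size_enum_ord.
have sP c : sorted leq (map val (s c)).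
  by rewrite sorted_map; apply: sort_sorted => x y; apply: leq_total.
exists (Tuple size1, Tuple size2); first by rewrite /sorted_pair !sP.
have part c : perm_eq [seq (c, x) | x <- s c] [seq x <- colours f | x.1 == c].
  apply: (@perm_trans _ [seq (c, x) | x <- [seq x.2 | x <- colours f & x.1 == c]]).
    by rewrite perm_map // perm_sort.
  rewrite -map_comp (_ : [seq _ | _ <- _] = [seq x <- colours f | x.1 == c]) //.
  by elim: (colours f) => //= -[d x] t IH /=; case: eqP => //= ->; rewrite IH.
rewrite perm_sym; apply: perm_trans (perm_cat (part true) (part false)) _.
rewrite (eq_filter (a1 := fun x => x.1 == false) (a2 := predC (fun x => x.1 == true))).
  by rewrite perm_filterC.
by move=> x /=; case: x.1.
Qed.

Lemma sum_stabilisers_colourings :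
  \sum_(f | marked f == a) weight (colours f) *+ #|[set w | recolour f w == f]|
  = (complete_sym F N a * complete_sym F N b) *+ n`!.
Proof.
transitivity (\sum_(f | marked f == a)
    \sum_(z | sorted_pair z && perm_eq (colours f) (word z))
      weight (word z) *+ #|[set w | recolour f w == f]|).
  apply: eq_bigr => f /eqP/word_exists[z zs fz].
  rewrite (bigD1 z) /= ?zs // big1 ?addr0.
    by rewrite /weight (perm_big _ fz).
  move=> z' /andP[/andP[zs' fz'] /eqP[]]; apply: word_inj => //.
  by apply: perm_trans fz; rewrite perm_sym.
rewrite (exchange_big_dep sorted_pair) /=; last by move=> f z _ /andP[].
rewrite -sum_word -sumrMnl; apply: eq_bigr => z zs.
have [f0 f0z] := colours_word z; rewrite -(sum_stabilisers f0) -sumrMnr f0z.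
apply: eq_bigl => f; rewrite zs /=; case: (boolP (perm_eq _ _)) => fz; rewrite ?andbF //.
by rewrite andbT /marked (seq.permP fz) count_word eqxx.
Qed.

(** A weighted Burnside count: the pairs (w, f) with f fixed by w are summed by f, and the
    stabilisers along one orbit add up to n!, so each orbit contributes its weight once. *)
Lemma frobenius_fixed_subsets : n`!%:R != 0 :> F ->
  frobenius_char N (fun w : 'S_n => (fixed_subsets a w)%:R)
  = complete_sym F N a * complete_sym F N b.
Proof.
move=> n0; rewrite /frobenius_char.
under eq_bigr do rewrite fixed_subsets_colourings big_mkcondr.
rewrite exchange_big /=; apply: (scalerI n0); rewrite scalerA mulfV // scale1r.
rewrite scaler_nat -sum_stabilisers_colourings; apply: eq_bigr => f _.
by rewrite -big_mkcond sumr_const; congr (_ *+ _); apply: eq_card => w; rewrite inE.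
Qed.

End Words.

End Frobenius.

(** * Schur functions of one row and of the shape with one extra box *)

Section Schur.
Variables (F : fieldType) (N : nat).
Local Notation mpoly := {mpoly F[N]}.

Lemma sorted_tupleP n (t : n.-tuple 'I_N) :
  reflect (forall i j : 'I_n, (i < j)%N -> (tnth t i <= tnth t j)%N)
    (sorted leq (map val t)).
Proof.
case: n t => [|n] t; first by rewrite tuple0; apply: ReflectT => -[].
rewrite sorted_pairwise; last exact: leq_trans.
have tE (i : 'I_n.+1) : tnth t i = nth 0%N (map val t) i :> nat.
  by rewrite (nth_map (tnth t i)) ?size_tuple // -tnth_nth.
apply: (iffP (pairwiseP 0%N)) => h i j.
  by move=> ij; rewrite !tE; apply: h; rewrite ?inE ?size_map ?size_tuple.
rewrite !inE !size_map !size_tuple => iN jN ij.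
by have := h (Ordinal iN) (Ordinal jN) ij; rewrite !tE.
Qed.

Lemma prod_tuple n (t : n.-tuple 'I_N) :
  \prod_(x <- t) 'X_x = \prod_(i < n) 'X_(tnth t i) :> mpoly.
Proof. by rewrite big_tuple. Qed.

Section Row.
Variable n : nat.

Definition row_cell (j : 'I_n) : cell [:: n] := exist _ (ord0, j) (ltn_ord j).

Lemma row_cellP (c : cell [:: n]) : exists j, c = row_cell j.
Proof.
case: c => -[i j] ij; exists j; apply: val_inj => /=; congr (_, _).
exact: ord1.
Qed.

Definition row_of (T : {ffun cell [:: n] -> 'I_N}) : n.-tuple 'I_N :=
  [tuple T (row_cell j) | j < n].

Lemma tnth_row_of T j : tnth (row_of T) j = T (row_cell j).
Proof. exact: tnth_mktuple. Qed.

Lemma schur_row : schur F N [:: n] = complete_sym F N n.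
Proof.
rewrite /schur /complete_sym.
rewrite (reindex row_of).
  apply: eq_big => [T|T _].
    apply/andP/sorted_tupleP => [[/forallP rowT _] j k jk|h].
      rewrite !tnth_row_of.
      by have /forallP/(_ (row_cell k)) := rowT (row_cell j); rewrite /= jk.
    split; apply/forallP => c; apply/forallP => c';
      have [j ->] := row_cellP c; have [k ->] := row_cellP c'; rewrite /= ?andbF //.
    by apply/implyP => /h; rewrite !tnth_row_of.
  rewrite prod_tuple (reindex row_cell) /=.
    by apply: eq_bigr => j _; rewrite tnth_row_of.
  exists (fun c : cell [:: n] => (val c).2) => [//|c _].
  by have [j ->] := row_cellP c.
exists (fun t : n.-tuple 'I_N => [ffun c : cell [:: n] => tnth t (val c).2]).
  move=> T _; apply/ffunP => c; rewrite ffunE tnth_row_of.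
  by have [j ->] := row_cellP c.
by move=> t _; apply: eq_from_tnth => j; rewrite tnth_row_of ffunE.
Qed.

End Row.

Lemma complete_sym1 : complete_sym F N 1 = \sum_(x < N) 'X_x.
Proof.
rewrite /complete_sym (reindex (fun x : 'I_N => [tuple x])) /=.
  by apply: eq_bigr => x _; rewrite big_seq1.
exists (fun t : 1.-tuple 'I_N => thead t) => [x _|t _]; first by rewrite theadE.
by apply: eq_from_tnth => j; rewrite [j]ord1 /thead.
Qed.

(** Splits off the first, smallest variable, in the form to be compared with h_(m+1) h_1. *)
Lemma complete_symS m : complete_sym F N m.+2
  = \sum_(z : m.+1.-tuple 'I_N * 'I_N |
      sorted leq (map val z.1) && (z.2 <= thead z.1)%N)
      (\prod_(x <- z.1) 'X_x) * 'X_(z.2).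
Proof.
rewrite /complete_sym.
rewrite (reindex (fun z : m.+1.-tuple 'I_N * 'I_N => [tuple of z.2 :: z.1])) /=.
  apply: eq_big => [[t x] /=|[t x] _]; last by rewrite big_cons mulrC.
  by case/tupleP: t => y t; rewrite /= theadE andbC.
exists (fun t : m.+2.-tuple 'I_N => ([tuple of behead t], thead t)).
  by case=> t x _ /=; congr (_, _); apply: val_inj.
by move=> t _ /=; rewrite -tuple_eta.
Qed.

Section Hook.
Variable m : nat.
Local Notation hook := [:: m.+1; 1%N].

Definition hook_cell (j : 'I_m.+1) : cell hook := exist _ (ord0, j) (ltn_ord j).
Definition hook_foot : cell hook := exist _ (ord_max, ord0) isT.

Lemma hook_cellP (c : cell hook) : (exists j, c = hook_cell j) \/ c = hook_foot.
Proof.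
case: c => -[[[|[|//]] i2] j] /= ij; [left; exists j | right]; apply: val_inj => /=.
  by congr (_, _); apply: val_inj.
congr (_, _); apply: val_inj => //=; move: ij => /=.
by rewrite ltnS leqn0 => /eqP.
Qed.

Definition hook_pair (T : {ffun cell hook -> 'I_N}) : m.+1.-tuple 'I_N * 'I_N :=
  ([tuple T (hook_cell j) | j < m.+1], T hook_foot).

Lemma hook_pair1 T j : tnth (hook_pair T).1 j = T (hook_cell j).
Proof. exact: tnth_mktuple. Qed.

Lemma hook_pair2 T : (hook_pair T).2 = T hook_foot.
Proof. by []. Qed.

(** Pieri rule for one box: the extra variable of a term of h_(m+1) h_1 is at most the first entry
    of the row and can be put in front of it, or exceeds it and can be put below it. *)
Lemma schur_hook : schur F N hook
  = complete_sym F N m.+1 * complete_sym F N 1 - complete_sym F N m.+2.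
Proof.
apply/eqP; rewrite eq_sym subr_eq; apply/eqP.
rewrite complete_symS complete_sym1 [X in X * _]/complete_sym big_distrlr pair_big /=.
rewrite (bigID (fun z : m.+1.-tuple 'I_N * 'I_N => z.2 <= thead z.1)%N) /= addrC.
congr (_ + _); last by apply: eq_bigl => z; rewrite andbT.
rewrite /schur (reindex hook_pair).
  apply: eq_big => [T|T _].
    rewrite andbT -ltnNge /thead hook_pair1 hook_pair2.
    apply/andP/andP => [[/sorted_tupleP h lt0]|[/forallP rowT /forallP colT]].
      split; apply/forallP => c; apply/forallP => c';
        have [[j ->]|->] := hook_cellP c; have [[k ->]|->] := hook_cellP c';
        apply/implyP; rewrite //= ?andbF //.
        by move/h; rewrite !hook_pair1.
      by case/andP => /eqP -> _.
    split.
      apply/sorted_tupleP => j k jk; rewrite !hook_pair1.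
      by have /forallP/(_ (hook_cell k)) := rowT (hook_cell j); rewrite /= jk.
    by have /forallP/(_ hook_foot) := colT (hook_cell ord0).
  rewrite prod_tuple hook_pair2 (bigD1 hook_foot) //= mulrC; congr (_ * _).
  rewrite (reindex hook_cell) /=.
    by apply: eq_big => [j|j _]; rewrite ?hook_pair1.
  exists (fun c : cell hook => (val c).2) => [//|c].
  by rewrite inE; have [[j ->]|->] := hook_cellP c; rewrite ?eqxx.
exists (fun z : m.+1.-tuple 'I_N * 'I_N => [ffun c : cell hook =>
    if c == hook_foot then z.2 else tnth z.1 (val c).2]).
  move=> T _; apply/ffunP => c; rewrite ffunE.
  by have [[j ->]|->] := hook_cellP c; rewrite ?eqxx //= hook_pair1.
move=> [t x] _ /=; congr (_, _); last by rewrite ffunE eqxx.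
by apply: eq_from_tnth => j; rewrite hook_pair1 ffunE.
Qed.

End Hook.
End Schur.

(** * The two characteristics *)

Section FrobeniusLinear.
Variables (F : fieldType) (n N : nat).

Lemma eq_frobenius_char (chi psi : 'S_n -> F) :
  chi =1 psi -> frobenius_char N chi = frobenius_char N psi.
Proof. by move=> e; rewrite /frobenius_char; under eq_bigr do rewrite e. Qed.

Lemma frobenius_charD (chi psi : 'S_n -> F) :
  frobenius_char N (fun w => chi w + psi w)
  = frobenius_char N chi + frobenius_char N psi.
Proof.
rewrite /frobenius_char -scalerDr -big_split; congr (_ *: _).
by apply: eq_bigr => w _; rewrite scalerDl.
Qed.

Lemma frobenius_charZ a (chi : 'S_n -> F) :
  frobenius_char N (fun w => a * chi w) = a *: frobenius_char N chi.
Proof.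
rewrite /frobenius_char [RHS]scalerA [a * _]mulrC -scalerA; congr (_ *: _).
rewrite scaler_sumr.
by apply: eq_bigr => w _; rewrite scalerA.
Qed.

Lemma frobenius_char_sum (I : finType) (P : pred I) (chi : I -> 'S_n -> F) :
  frobenius_char N (fun w => \sum_(j | P j) chi j w)
  = \sum_(j | P j) frobenius_char N (chi j).
Proof.
rewrite /frobenius_char -scaler_sumr exchange_big; congr (_ *: _).
by apply: eq_bigr => w _; rewrite scaler_suml.
Qed.

Lemma complete_sym0 : complete_sym F N 0 = 1.
Proof.
rewrite /complete_sym (big_pred1 [tuple]) ?big_nil // => t.
by rewrite [t]tuple0; apply/esym/eqP.
Qed.

Lemma fixed_subsets_full (w : 'S_n) : fixed_subsets n w = 1%N.
Proof.
rewrite /fixed_subsets -(cards1 [set: 'I_n]); apply: eq_card => S.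
rewrite !inE; apply/andP/eqP => [[/eqP Sn _]|->].
  by apply/eqP; rewrite eqEcard subsetT Sn cardsT card_ord leqnn.
rewrite cardsT card_ord eqxx; split=> //; apply/eqP/setP => x.
by rewrite inE -[x](permKV w) (mem_imset _ _ perm_inj) inE.
Qed.

End FrobeniusLinear.

(** * Cut edges and 2-connected subgraphs attached to blocks *)

Section Edges.
Variables (n : nat) (G : graph 'I_n).
Hypothesis G_full : G.1 = [set: 'I_n].
Hypothesis G_simple : simple_graph G.
Hypothesis G_conn : connected_graph G.

Local Notation adj := (adjacent G).
Local Notation adj_sym := (adjacent_sym G).
Local Notation adj_irr := (adjacent_irr G_simple).
Local Notation adj_conn := (adjacent_connect G_full G_conn).

Definition edge (y : 'I_n * 'I_n) : {set 'I_n} := [set y.1; y.2].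

(** Once the edge is deleted, no path leaves [side y y.2], which contains [y.1] but not [y.2]. *)
Lemma bridge_cut_edge y : y \in blocks adj -> bridge adj y ->
  edge y \in cut_edges G.
Proof.
move=> yB yb; rewrite inE; have yE : edge y \in G.2 by apply: block_adj yB.
rewrite yE; apply/negP => /andP[_ /forall_inP].
rewrite /= G_full => /(_ y.1 (in_setT _)) /forall_inP/(_ y.2 (in_setT _)) c12.
suff : y.2 \in side adj y y.2 by rewrite (negPf (notin_side adj_irr _ _)).
apply: (connect_ind (P := fun u => u \in side adj y y.2)) c12 _; last first.
  exact: (fst_side2 adj_sym adj_irr yB).
move=> u v /setD1P[uvy uv] uy.
apply: contraNT uvy => vy; apply/eqP.
by rewrite /edge -(bridge_leave adj_sym adj_irr adj_conn yB yb uv uy vy).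
Qed.

Lemma edge_two_connected y : y \in blocks adj ->
  (edge y, [set edge y]) \in two_connected_subgraphs G.
Proof.
move=> yB; have yE : edge y \in G.2 by apply: block_adj yB.
have y12 := adj_neq adj_irr (block_adj yB).
have edge2 : #|edge y| = 2%N by rewrite cards2 y12.
rewrite inE; apply/andP; split.
  rewrite /subgraph /= G_full subsetT sub1set yE !andbT.
  by apply/forall_inP => e; rewrite inE => /eqP ->; rewrite edge2 eqxx /=.
apply/andP; split.
  apply/andP; split; first by apply/set0Pn; exists y.1; rewrite !inE eqxx.
  apply/forall_inP => x xy; apply/forall_inP => z zy /=.
  case: (eqVneq x z) => [->|xz]; first exact: connect0.
  apply: connect1; rewrite /adjacent /= inE eqEcard edge2 cards2 xz.
  by rewrite subUset !sub1set xy zy.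
apply/forall_inP => x xy; rewrite /connected_graph /=.
have /eqP/cards1P[z ->] : #|edge y :\ x| = 1%N.
  by move: edge2; rewrite (cardsD1 x) xy => -[].
apply/andP; split; first by apply/set0Pn; exists z; rewrite inE.
apply/forall_inP => u; rewrite inE => /eqP ->.
by apply/forall_inP => v; rewrite inE => /eqP ->; apply: connect0.
Qed.

Lemma block_side_bounds y : y \in blocks adj ->
  (0 < #|block_side adj y| < n)%N.
Proof.
move=> yB; have y1 := fst_block_side adj_sym adj_irr yB.
have y2 := snd_block_side adj_irr yB.
apply/andP; split; first by apply/card_gt0P; exists y.1.
rewrite -[X in (_ < X)%N]card_ord -cardsT; apply: proper_card.
by apply/properP; split; [apply: subsetT | exists y.2; rewrite ?inE].
Qed.

End Edges.

(** Sorted, because the half of [y.1] may be the larger or the smaller one. *)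
Definition two_part (n a : nat) : seq nat := [:: maxn a (n - a); minn a (n - a)].

Lemma two_part_partition n a : (0 < a < n)%N -> is_partition n (two_part n a).
Proof.
move=> an; rewrite /is_partition /two_part /= !inE andbT addn0.
by apply/and3P; split; lia.
Qed.

Lemma complete_sym_two_part (F : fieldType) N n a :
  complete_sym_part F N (two_part n a) = complete_sym F N a * complete_sym F N (n - a).
Proof.
rewrite /complete_sym_part /two_part !big_cons big_nil mulr1 /maxn /minn.
by case: ltnP => // _; rewrite mulrC.
Qed.

Theorem theoremD (R : realType) (n : nat) (hn : (3 <= n)%N)
    (Gamma : graph 'I_n)
    (hvertices : Gamma.1 = [set: 'I_n])
    (hsimple : simple_graph Gamma)
    (hconn : connected_graph Gamma) :
  exists (E1 : {set {set 'I_n}}) (E2 : {set {set 'I_n} * {set {set 'I_n}}})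
      (k : nat) (lam : {set 'I_n} -> seq nat),
    [/\ E1 \subset cut_edges Gamma,
        E2 \subset two_connected_subgraphs Gamma,
        forall e, e \in E1 -> is_partition n (lam e),
        forall N : nat,
          ch_L R[i]%C N Gamma 1 =
            \sum_(e in E1) complete_sym_part R[i]%C N (lam e)
            + (#|E2|%:R - 1) *: complete_sym_part R[i]%C N [:: n.-1; 1%N]
            + k%:R *: complete_sym_part R[i]%C N [:: n]
      & forall N : nat,
          ch_R R[i]%C N Gamma 1 =
            \sum_(e in E1) (complete_sym_part R[i]%C N (lam e)
                            - schur R[i]%C N [:: n])
            + #|E2|%:R *: schur R[i]%C N [:: n.-1; 1%N]].
Proof.
pose adj := adjacent Gamma.
pose B1 := [set y in blocks adj | bridge adj y].
pose B2 := [set y in blocks adj | ~~ bridge adj y].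
have B1P y : y \in B1 -> y \in blocks adj /\ bridge adj y by rewrite inE => /andP.
have B2P y : y \in B2 -> y \in blocks adj /\ ~~ bridge adj y by rewrite inE => /andP.
have edge_inj : {in blocks adj &, injective (@edge n)}.
  exact: block_edge_inj (adjacent_sym Gamma).
(* The size of the half of [y.1] for the bridge y with edge e; 1 is a default for all other e. *)
pose a (e : {set 'I_n}) : nat :=
  if [pick y in B1 | edge y == e] is Some y then #|block_side adj y| else 1%N.
have aE y : y \in B1 -> a (edge y) = #|block_side adj y|.
  move=> yB1; rewrite /a; case: pickP => [z /andP[zB1 /eqP zy]|/(_ y)].
    by have [yB _] := B1P y yB1; have [zB _] := B1P z zB1; rewrite (edge_inj z y).
  by rewrite yB1 eqxx.
have edge_inj1 : {in B1 &, injective (@edge n)}.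
  by move=> y z /B1P[yB _] /B1P[zB _]; apply: edge_inj.
(* The subtraction defining k is exact by [card_blocks]. *)
exists (@edge n @: B1), [set (edge y, [set edge y]) | y in B2], (n - #|blocks adj|)%N,
  (fun e => two_part n (a e)).
have cardE2 : #|[set (edge y, [set edge y]) | y in B2]| = #|B2|.
  by apply: card_in_imset => y z /B2P[yB _] /B2P[zB _] [e _]; apply: edge_inj.
have blocksE : blocks adj = B1 :|: B2.
  by apply/setP => y; rewrite !inE -andb_orr orbN andbT.
have disj : [disjoint B1 & B2].
  rewrite -setI_eq0; apply/eqP/setP => y; rewrite !inE.
  by case: (bridge _ _); rewrite ?andbF.
have card_blocksE : #|blocks adj| = (#|B1| + #|B2|)%N.
  by rewrite blocksE cardsU disjoint_setI0 // cards0 subn0.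
have blocks_le : (#|blocks adj| <= n)%N.
  have x0 : 'I_n by apply: (Ordinal (_ : 0 < n)%N); lia.
  rewrite -[X in (_ <= X)%N]card_ord.
  apply: card_blocks x0; [exact: adjacent_sym | exact: adjacent_irr | ].
  exact: adjacent_connect.
have sumB (w : 'S_n) : \sum_(y in blocks adj) (fixed_subsets #|block_side adj y| w)%:R
    = \sum_(y in B1) (fixed_subsets #|block_side adj y| w)%:R
      + #|B2|%:R * (fixed_subsets 1 w)%:R :> R[i].
  rewrite (bigID (bridge adj)) /=; congr (_ + _).
    by apply: eq_bigl => y; rewrite !inE.
  rewrite mulr_natl -sumr_const; apply: eq_big => [y|y /andP[_ yb]].
    by rewrite !inE.
  by rewrite /block_side (negPf yb) cards1.
have fact0 : n`!%:R != 0 :> R[i] by rewrite Num.Theory.pnatr_eq0 -lt0n fact_gt0.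
have frob N b : (b <= n)%N ->
    frobenius_char N (fun w : 'S_n => (fixed_subsets b w)%:R)
    = complete_sym R[i] N b * complete_sym R[i] N (n - b).
  by move=> bn; apply: frobenius_fixed_subsets fact0; rewrite subnKC.
have frob1 N : frobenius_char N (fun w : 'S_n => (fixed_subsets 1 w)%:R)
    = complete_sym_part R[i] N [:: n.-1; 1%N].
  rewrite frob; last by lia.
  by rewrite /complete_sym_part !big_cons big_nil mulr1 mulrC subn1.
have frobn N : frobenius_char N (fun w : 'S_n => (fixed_subsets n w)%:R)
    = complete_sym R[i] N n.
  by rewrite frob // subnn complete_sym0 mulr1.
have sumE1 N : frobenius_char N
      (fun w : 'S_n => \sum_(y in B1) (fixed_subsets #|block_side adj y| w)%:R)
    = \sum_(e in @edge n @: B1) complete_sym_part R[i] N (two_part n (a e)).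
  rewrite frobenius_char_sum big_imset //=; apply: eq_bigr => y yB1.
  have [yB _] := B1P y yB1; have /andP[_ /ltnW yn] := block_side_bounds hsimple yB.
  by rewrite frob // complete_sym_two_part aE.
split.
- apply/subsetP => _ /imsetP[y /B1P[yB yb] ->].
  exact: bridge_cut_edge.
- apply/subsetP => _ /imsetP[y /B2P[yB _] ->].
  exact: edge_two_connected.
- move=> _ /imsetP[y yB1 ->]; apply: two_part_partition; rewrite aE //.
  by apply: block_side_bounds => //; case: (B1P y yB1).
- move=> N; rewrite cardE2 /ch_L.
  rewrite (eq_frobenius_char N (psi := fun w =>
    (\sum_(y in B1) (fixed_subsets #|block_side adj y| w)%:R
     + (#|B2|%:R - 1) * (fixed_subsets 1 w)%:R)
    + (n - #|blocks adj|)%:R * (fixed_subsets n w)%:R)).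
    rewrite frobenius_charD frobenius_charD !frobenius_charZ sumE1 frob1 frobn.
    by rewrite [in RHS]/complete_sym_part big_seq1.
  move=> w; rewrite L_characterE // sumB fixed_subsets_full mulr1 natrB //.
  by rewrite mulrBl mul1r -!addrA; congr (_ + (_ + _)); rewrite [RHS]addrC addrA.
- move=> N; rewrite cardE2 /ch_R.
  rewrite (eq_frobenius_char N (psi := fun w =>
    (\sum_(y in B1) (fixed_subsets #|block_side adj y| w)%:R
     + #|B2|%:R * (fixed_subsets 1 w)%:R)
    + (- #|blocks adj|%:R) * (fixed_subsets n w)%:R)).
    rewrite frobenius_charD frobenius_charD !frobenius_charZ sumE1 frob1 frobn.
    rewrite sumrB sumr_const card_in_imset // schur_row.
    have -> : schur R[i] N [:: n.-1; 1%N]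
        = complete_sym_part R[i] N [:: n.-1; 1%N] - complete_sym R[i] N n.
      have [m ->] : exists m, n = m.+2 by exists n.-2; lia.
      by rewrite /= schur_hook /complete_sym_part !big_cons big_nil mulr1.
    rewrite card_blocksE natrD scalerBr opprD scalerDl !scaleNr !scaler_nat.
    by rewrite !addrA; congr (_ - _); rewrite addrAC.
  by move=> w; rewrite R_characterE // sumB fixed_subsets_full mulr1.
Qed.
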